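(* Let $H\in[\tfrac12,1]$. Then the function $g(m)=E\log\left(\int_{-\infty}^{\infty}Z_u e^{mu}\,du\right)$ is twice continuously differentiable on the interval $m\in(-1/8,1/8)$, and \[ \operatorname{Var}(\zeta_H)=\frac{\partial^2 g(m)}{\partial m^2}\Big|_{m=0}. \]
   Context: Let $W^H=\{W^H_s,\ s\in\mathbb{R}\}$ be a two-sided fractional Brownian motion with Hurst parameter $H$: a centered Gaussian process with continuous trajectories, $W^H_0=0$, and $E|W^H_s-W^H_t|^2=|s-t|^{2H}$ for all $s,t\in\mathbb{R}$. Define $Z_t=\exp\{W^H_t-\tfrac12|t|^{2H}\}$, $q_t=Z_t\left(\int_{-\infty}^{\infty}Z_u\,du\right)^{-1}$ for $t\in\mathbb{R}$, and $\zeta_H=\int_{-\infty}^{\infty} t\,q_t\,dt$. *)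

(* Defs.v *)
From HB Require Import structures.
From mathcomp Require Import all_boot all_order all_algebra.
From mathcomp Require Import all_classical all_reals all_analysis.
From mathcomp Require Import probability normal_distribution.
Set Implicit Arguments. Unset Strict Implicit. Unset Printing Implicit Defensive.
Import Order.TTheory GRing.Theory Num.Theory.
Import numFieldNormedType.Exports.
Local Open Scope classical_set_scope.
Local Open Scope ring_scope.

Section fbm.
Context {d : measure_display} {T : measurableType d} {R : realType}
  (P : probability T R).

Definition centered_gaussian (X : T -> R) (v : R) : Prop :=
  measurable_fun setT X /\ 0 <= v /\
  (v = 0 -> P (X @^-1` [set 0]) = 1%E) /\
  (0 < v -> forall A : set R, measurable A ->
     P (X @^-1` A) = normal_prob 0 (Num.sqrt v) A).

Definition centered_gaussian_process (W : R -> T -> R) : Prop :=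
  forall (n : nat) (t : 'I_n -> R) (c : 'I_n -> R),
    exists v : R, centered_gaussian (fun w => \sum_(i < n) c i * W (t i) w) v.

Definition is_fBM (H : R) (W : R -> T -> R) : Prop :=
  [/\ centered_gaussian_process W,
      (forall w, continuous (fun s => W s w)),
      (forall w, W 0 w = 0) &
      (forall s t, ('E_P[fun w => ((W s w - W t w) ^+ 2)%R]
                   = (`|s - t| `^ (2 * H))%:E)%E)].

Definition Zproc (H : R) (W : R -> T -> R) (t : R) (w : T) : R :=
  expR (W t w - (`|t| `^ (2 * H)) / 2).

Definition Zmass (H : R) (W : R -> T -> R) (m : R) (w : T) : \bar R :=
  (\int[lebesgue_measure]_u (Zproc H W u w * expR (m * u))%:E)%E.

Definition logZmass (H : R) (W : R -> T -> R) (m : R) (w : T) : R :=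
  ln (fine (Zmass H W m w)).

Definition qdens (H : R) (W : R -> T -> R) (t : R) (w : T) : R :=
  Zproc H W t w / fine (Zmass H W 0 w).

Definition zetaH (H : R) (W : R -> T -> R) (w : T) : R :=
  fine (\int[lebesgue_measure]_t (t * qdens H W t w)%:E)%E.

End fbm.

(* Main.v *)
(**
Write [f t = |t|^{2H}], so that [Z_u = exp (W_u - f u / 2)].

Derivatives of [g].  By Jensen's inequality the mass of [Z e^{mu}] over a unit
interval is at least [(\int Z_v^{-1/2} e^{-mv/2} dv)^{-2}].  Applied to a unit
interval next to [u] and to [0, 1] it bounds the density
[q^m_u = Z_u e^{mu} / \int Z e^{mv} dv] by an integral of
[Z_u Z_v^{-1/2} Z_r^{-1/2} e^{mu/2}] with [v] near [u] and [r] in [0, 1], whose mean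
is explicit and decays exponentially in [u].  This dominates all moments of
[q^m] uniformly in [m], so that [g' = E (mean of q^m)] and [g'' = E (variance of q^m)].

Variance.  Under the density [Z_t] the process [s |-> Z_{t-s} / Z_t] has the law of
[Z].  Applied to [(zeta + c)^2 q_t] this gives
[E ((t - zeta + c)^2 q_t) = E ((zeta + c)^2 q_t)]; integrating over [t] yields
[E (variance of q) + c^2 = E (zeta + c)^2] for every [c], that is [E zeta = 0] and
[E zeta^2 = g''(0)].

The equality of laws only uses the Laplace transforms of linear combinations.
Pairs of weights having the same Laplace transforms are stable under multiplication by
[sin (a X_t + b)], since its power series is dominated by exponentials; iterating a
cubic polynomial on [sin] yields the sign function, hence all cylinder sets.
*)

Require Import Defs.
From HB Require Import structures.
From mathcomp Require Import all_boot all_order all_algebra.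
From mathcomp Require Import all_classical all_reals all_analysis.
From mathcomp Require Import probability normal_distribution.
From mathcomp Require Import measurable_realfun lebesgue_integral ring lra.
Set Implicit Arguments. Unset Strict Implicit. Unset Printing Implicit Defensive.
Import Order.TTheory GRing.Theory Num.Theory.
Import numFieldNormedType.Exports.
Import HBNNSimple.
Local Open Scope classical_set_scope.
Local Open Scope ring_scope.
Local Notation leb := lebesgue_measure.

(** * Gaussian moments *)

(** The obstacle is the random denominator [D = \int Z_v e^{mv} dv]: bounding [Z_u e^{mu} / D] needs
    a lower bound on [D], and a single unit interval does not suffice. An interval near [0] alone
    leads to [Z_u / Z_r], one near [u] alone to [Z_u / Z_v], and these means need not decay in
    [|u|]. Writing [1 / D = D^{-1/2} D^{-1/2}], with one factor estimated near [u] and the other on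
    [[0, 1]], leaves roughly [Z_u^{1/2} Z_r^{-1/2}], of mean about [exp (- f u / 8)]. As [2 H >= 1],
    [f u >= |u|] for [|u| >= 1], which beats a small exponential tilt.

    The factor near [u] alone already gives [D < +oo]: on a bounded window it bounds [sqrt D] by a
    random variable that does not depend on the window.

    The variance identity is stated for nonnegative integrands with values in the extended reals,
    because [zeta] is not yet known to be square integrable. The case [c = 0] supplies that, and
    [c = 1] then gives the mean. *)

(** Approximation by simple functions. With weights and two unrelated source spaces, the same
    statement covers the passage from a Gaussian law to its density and the comparison of path laws
    under a change of measure. *)
Lemma ge0_integral_transfer (R : realType) (d1 d2 d : measure_display)
    (T1 : measurableType d1) (T2 : measurableType d2) (E : measurableType d)
    (mu1 : {measure set T1 -> \bar R}) (mu2 : {measure set T2 -> \bar R})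
    (X1 : T1 -> E) (X2 : T2 -> E) (U1 : T1 -> R) (U2 : T2 -> R)
    (F : E -> R) :
  measurable_fun setT X1 -> measurable_fun setT X2 ->
  measurable_fun setT U1 -> measurable_fun setT U2 ->
  (forall x, 0 <= U1 x) -> (forall x, 0 <= U2 x) ->
  (forall A : set E, measurable A ->
    (\int[mu1]_x (U1 x * \1_A (X1 x))%:E = \int[mu2]_x (U2 x * \1_A (X2 x))%:E)%E) ->
  measurable_fun setT F -> (forall x, 0 <= F x) ->
  (\int[mu1]_x (U1 x * F (X1 x))%:E = \int[mu2]_x (U2 x * F (X2 x))%:E)%E.
Proof.
move=> mX1 mX2 mU1 mU2 U10 U20 H mF F0.
have mF' : measurable_fun setT (fun x => (F x)%:E) by exact/measurable_EFinP.
pose f_ := nnsfun_approx measurableT mF'.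
have key d0 (T0 : measurableType d0) (mu : {measure set T0 -> \bar R})
   (X : T0 -> E) (U : T0 -> R) : measurable_fun setT X -> measurable_fun setT U ->
   (forall x, 0 <= U x) ->
   (\int[mu]_x (U x * F (X x))%:E =
    limn (fun n => \int[mu]_x (U x * f_ n (X x))%:E))%E.
  move=> mX mU U0; rewrite -monotone_convergence//=; last 3 first.
  - move=> n; apply/measurable_EFinP; apply: measurable_funM => //.
    exact: measurableT_comp.
  - by move=> n x _; rewrite lee_fin mulr_ge0.
  - move=> x _ m n mn; rewrite lee_fin ler_wpM2l//.
    exact/lefP/nd_nnsfun_approx.
  apply: eq_integral => x _; apply/esym/cvg_lim => //.
  rewrite EFinM; under eq_fun do rewrite EFinM.
  apply: cvgeZl => //.
  by apply: cvg_nnsfun_approx => // y _; rewrite lee_fin.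
rewrite !key//; congr (limn _); apply/funext => n.
have key2 d0 (T0 : measurableType d0) (mu : {measure set T0 -> \bar R})
   (X : T0 -> E) (U : T0 -> R) : measurable_fun setT X -> measurable_fun setT U ->
   (forall x, 0 <= U x) ->
   (\int[mu]_x (U x * f_ n (X x))%:E =
    \sum_(y \in range (f_ n)) y%:E * \int[mu]_x (U x * \1_(f_ n @^-1` [set y]) (X x))%:E)%E.
  move=> mX mU U0.
  transitivity (\int[mu]_x \sum_(y \in range (f_ n))
     (y%:E * (U x * \1_(f_ n @^-1` [set y]) (X x))%:E))%E.
    apply: eq_integral => x _.
    rewrite (fimfunE (f_ n) (X x)) fsbig_finite//= mulr_sumr -sumEFin fsbig_finite//=.
    by apply: eq_bigr => y _; rewrite -EFinM mulrCA.
  have mI y : measurable_fun setT (fun x => (U x * \1_(f_ n @^-1` [set y]) (X x))).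
    apply: measurable_funM => //.
    by apply: measurableT_comp => //; apply: measurable_indic.
  rewrite ge0_integral_fsum//.
  - apply: eq_fsbigr => y /set_mem[z _ <-].
    rewrite ge0_integralZl_EFin//.
    + by move=> x _; rewrite lee_fin mulr_ge0.
    + by apply/measurable_EFinP; exact: mI.
  - by move=> y; apply: measurable_funeM; apply/measurable_EFinP; exact: mI.
  - move=> y x _; rewrite -EFinM lee_fin.
    have [->|yn] := eqVneq y (f_ n (X x)); first by rewrite mulr_ge0// mulr_ge0.
    by rewrite indicE memNset ?mulr0//= => /esym/eqP; rewrite (negbTE yn).
rewrite !key2//; apply: eq_fsbigr => y _; congr (_ * _)%E.
exact: H.
Qed.

Section normal_mgf.
Context {R : realType}.

(** Completing the square. *)
Lemma expR_mul_normal_pdf (a s x : R) : s != 0 ->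
  expR (a * x) * normal_pdf 0 s x = expR (a ^+ 2 * s ^+ 2 / 2) * normal_pdf (a * s ^+ 2) s x.
Proof.
move=> s0; rewrite !normal_pdfE// mulrCA [RHS]mulrCA; congr (_ * _).
rewrite /normal_fun -!expRD; congr expR.
by field.
Qed.

End normal_mgf.

Section centered_gaussian_moments.
Context d (T : measurableType d) (R : realType) (P : probability T R).
Variables (X : T -> R) (v : R).
Hypothesis gX : centered_gaussian P X v.

Let mX : measurable_fun setT X. Proof. by case: gX. Qed.

Lemma centered_gaussian_mgf (a : R) :
  (\int[P]_w (expR (a * X w))%:E = (expR (a ^+ 2 * v / 2))%:E)%E.
Proof.
case: gX => _ [v0 [gX0 gXp]].
have mE : measurable_fun setT (fun w => expR (a * X w)).
  by apply: measurableT_comp => //; apply: measurable_funM.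
(* A null variance has no density; it is treated through the almost sure value [0]. *)
move: v0; rewrite le_eqVlt => /orP[/eqP v0|v0].
  rewrite -v0 mulr0 mul0r expR0.
  have mN : measurable (X @^-1` [set 0]).
    by rewrite -[X @^-1` _]setTI; exact: mX.
  rewrite (_ : 1%:E = \int[P]_w 1)%E; last by rewrite integral_cst//= probability_setT mule1.
  apply: ge0_ae_eq_integral => //.
  - exact/measurable_EFinP.
  - exists (~` (X @^-1` [set 0])); split.
    + exact: measurableC.
    + by rewrite /= probability_setC// gX0// subee.
    + move=> w /= /not_implyP[_]; apply: contra_not => /= ->.
      by rewrite mulr0 expR0.
have s0 : Num.sqrt v != 0 by rewrite gt_eqF// sqrtr_gt0.
transitivity (\int[leb]_x (normal_pdf 0 (Num.sqrt v) x * expR (a * x))%:E)%E.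
  under eq_integral do rewrite -(mul1r (expR _)).
  apply: (@ge0_integral_transfer _ _ _ _ T _ (measurableTypeR R) P leb X id
    (fun=> 1) (normal_pdf 0 (Num.sqrt v)) (fun x => expR (a * x))) => //.
  - exact: measurable_normal_pdf.
  - by move=> x; exact: normal_pdf_ge0.
  - move=> A mA.
    have mXA : measurable (X @^-1` A) by rewrite -[X @^-1` _]setTI; exact: mX.
    transitivity (P (X @^-1` A)).
      rewrite -[in RHS](setIT (X @^-1` A)) -integral_indic//; apply: eq_integral => x _.
      by rewrite mul1r.
    rewrite (gXp v0)// /normal_prob [LHS]integral_mkcond; apply: eq_integral => x _.
    by rewrite epatch_indic EFinM.
  - apply: measurableT_comp => //; exact: measurable_funM.
under eq_integral do rewrite mulrC expR_mul_normal_pdf// EFinM.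
rewrite ge0_integralZl_EFin//=; last 2 first.
  - by move=> x _; rewrite lee_fin normal_pdf_ge0.
  - by apply/measurable_EFinP; exact: measurable_normal_pdf.
by rewrite integral_normal_pdf mule1 sqr_sqrtr// ltW.
Qed.

Lemma integrable_expR_centered_gaussian (a : R) :
  P.-integrable setT (fun w => (expR (a * X w))%:E).
Proof.
apply/integrableP; split.
  by apply/measurable_EFinP; apply: measurableT_comp => //; apply: measurable_funM.
under eq_integral do rewrite gee0_abs ?lee_fin ?expR_ge0//.
by rewrite centered_gaussian_mgf ltry.
Qed.

End centered_gaussian_moments.

Section expR_difference_quotient.
Context {R : realType}.
Implicit Types y : R.

Lemma expR_normr_le y : expR `|y| <= expR y + expR (- y).
Proof.
have [y0|y0] := leP 0 y.
  by rewrite ger0_norm// lerDl expR_ge0.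
by rewrite ltr0_norm// lerDr expR_ge0.
Qed.

Lemma normr_le_expR y : `|y| <= expR `|y|.
Proof. by apply: le_trans (expR_ge1Dx _); rewrite lerDr. Qed.

Lemma expR_sub1_le y : `|expR y - 1| <= `|y| * expR `|y|.
Proof.
have [y0|y0] := leP 0 y.
  have e1 : 1 <= expR y by rewrite -expR0 ler_expR.
  rewrite ger0_norm ?subr_ge0// (ger0_norm y0).
  have := expR_ge1Dx (- y); have := expRxMexpNx_1 y; have := expR_gt0 y.
  by nra.
rewrite ltr0_norm ?subr_lt0 ?expR_lt1// ltr0_norm// opprB.
apply: (@le_trans _ _ (- y)); first by rewrite lerBlDr -lerBlDl opprK expR_ge1Dx.
by rewrite ler_peMr ?oppr_ge0 ?ltW// expR_gt1 oppr_gt0.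
Qed.

(** The difference quotient at [0], with step [1 / n.+1], of [a |-> expR (a * y)]. It recovers the
    factor [y] as a dominated limit of exponentials; second moments and polynomial weights are
    obtained from Laplace transforms in this way. *)
Definition expR_dq (n : nat) y := n.+1%:R * (expR (y / n.+1%:R) - 1).

Lemma expR_dq_le n y : `|expR_dq n y| <= `|y| * expR `|y|.
Proof.
rewrite /expR_dq normrM ger0_norm//.
apply: (@le_trans _ _ (n.+1%:R * (`|y / n.+1%:R| * expR `|y / n.+1%:R|))).
  by rewrite ler_wpM2l// expR_sub1_le.
rewrite normrM mulrA (ger0_norm (_ : 0 <= n.+1%:R^-1)) ?invr_ge0//.
rewrite (mulrC _ (`|y| / _)) mulrVK ?unitfE//.
rewrite ler_wpM2l// ler_expR ler_piMr// invf_le1// ler1n//.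
Qed.

Lemma expR_dq_cvg y : expR_dq n y @[n --> \oo] --> y.
Proof.
have [->|y0] := eqVneq y 0.
  rewrite /expR_dq; under eq_fun do rewrite mul0r expR0 subrr mulr0.
  exact: cvg_cst.
have dE : h^-1 * (expR (h + 0) - expR 0) @[h --> 0^'] --> (1 : R).
  have /cvg_ex[l hl] := @derivable_expR R 0.
  have <- : l = 1.
    have := derive_expR R => /(congr1 (fun f => f 0)); rewrite expR0 => <-.
    by apply/esym/cvg_lim; [exact: norm_hausdorff|exact: hl].
  by move: hl; under eq_fun do rewrite scaler1.
have tc : y / n.+1%:R @[n --> \oo] --> (0:R).
  rewrite -(mulr0 y); apply: cvgMl_tmp => //.
  exact: (@cvg_harmonic R).
have tn n : y / n.+1%:R != 0 by rewrite mulf_neq0// invr_eq0.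
move/cvgr_dnbhsP : dE => /(_ (fun n => y / n.+1%:R) (conj tn tc)) dE.
rewrite -[X in _ --> X](mulr1 y).
rewrite (_ : (fun n => _) = (fun n => y * ((y / n.+1%:R)^-1 * (expR (y / n.+1%:R + 0) - expR 0)))).
  by apply: cvgMl_tmp.
apply/funext => n; rewrite /expR_dq addr0 expR0 invfM invrK.
by rewrite -!mulrA mulVKf.
Qed.

End expR_difference_quotient.

Section dominated.
Context d (T : measurableType d) (R : realType) (mu : {measure set T -> \bar R}).

Lemma dominated_cvg_EFin (f_ : nat -> T -> R) (f g : T -> R) :
  (forall n, measurable_fun setT (f_ n)) ->
  (forall x, f_ n x @[n --> \oo] --> f x) ->
  mu.-integrable setT (fun x => (g x)%:E) ->
  (forall n x, `|f_ n x| <= g x) ->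
  [/\ measurable_fun setT f, mu.-integrable setT (fun x => (f x)%:E) &
   \int[mu]_x (f_ n x)%:E @[n --> \oo] --> \int[mu]_x (f x)%:E]%E.
Proof.
move=> mf cf ig fg.
have mf' : measurable_fun setT f.
  by apply: (@measurable_fun_cvg _ _ _ _ f_) => // x _; exact: cf.
have [] := @dominated_convergence _ _ _ mu setT measurableT
   (fun n x => (f_ n x)%:E) (fun x => (f x)%:E) (fun x => (g x)%:E).
- by move=> n; exact/measurable_EFinP.
- exact/measurable_EFinP.
- by apply: aeW => x _; apply: cvg_EFin; [exact: nearW|exact: cf].
- exact: ig.
- by apply: aeW => x n _; rewrite lee_fin.
by move=> ? _ ?; split.
Qed.

End dominated.

(** * Joint measurability of continuous processes *)

Section joint_measurability.
Context d (T : measurableType d) (R : realType).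

(* A path-continuous process is the pointwise limit of its values at the
   left ends of the intervals of length 1/n. *)
Lemma measurable_fun_continuous_process (W : R -> T -> R) :
  (forall t, measurable_fun setT (W t)) ->
  (forall w, continuous (fun t => W t w)) ->
  measurable_fun setT (fun p : T * R => W p.2 p.1).
Proof.
move=> mW cW.
pose N n : R := n.+1%:R.
have N0 n : 0 < N n by rewrite /N ltr0n.
pose q n (u : R) : R := (Num.floor (u * N n))%:~R / N n.
apply: (@measurable_fun_cvg _ _ _ _ (fun n (p : T * R) => W (q n p.2) p.1)) => //.
  move=> n _ A mA; rewrite setTI.
  rewrite (_ : _ @^-1` A = \bigcup_(k in [set: int])
    ((W (k%:~R / N n) @^-1` A) `*` ((fun u => u * N n) @^-1` `[k%:~R, (k + 1)%:~R[ ))); last first.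
    apply/seteqP; split=> [[w u]/= Aw|[w u] [k _ [/= Aw]]].
      exists (Num.floor (u * N n)) => //; split => //=.
      by rewrite in_itv/= floor_itv.
    by rewrite /= in_itv/= /q => /floor_def ->.
  apply: countable_bigcupT_measurable => // k; apply: measurableX.
    by rewrite -[X in measurable X]setTI; exact: mW.
  rewrite -[X in measurable X]setTI.
  have mm : measurable_fun setT (fun u : R => u * N n) by exact: measurable_funM.
  exact: mm.
move=> [w u] _ /=; apply: (@continuous_cvg _ _ _ _ _ (fun n => q n u) (fun t => W t w) u); first exact: cW.
have qle n : `|q n u - u| <= (N n)^-1.
  have /andP[h1 h2] := floor_itv (u * N n).
  have iN : (N n)^-1 * N n = 1 by rewrite mulVf// gt_eqF.
  have qN : q n u * N n = (Num.floor (u * N n))%:~R by rewrite -mulrA iN mulr1.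
  rewrite intrD in h2.
  rewrite ler_norml; apply/andP; split; rewrite -(ler_pM2r (N0 n)) ?mulNr mulrBl iN qN; lra.
apply/cvgrPdist_le => e e0.
have /cvgrPdist_le/(_ _ e0) := @cvg_harmonic R; apply: filterS => n.
rewrite sub0r normrN distrC => h; apply: le_trans (qle n) _.
by apply: le_trans h; rewrite ler_norm.
Qed.

End joint_measurability.

(** In [centered_gaussian_process] the parameter [v] is only existential; this identifies it as a
    second moment. The square is a dominated limit of squared difference quotients, whose means
    follow from the Laplace transform. *)
Lemma centered_gaussian_sqr d (T : measurableType d) (R : realType)
  (P : probability T R) (X : T -> R) (v : R) : centered_gaussian P X v ->
  (\int[P]_w (X w ^+ 2)%:E = v%:E)%E.
Proof.
move=> gX; have mX : measurable_fun setT X by case: gX.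
have ie a := integrable_expR_centered_gaussian gX a.
have [] := @dominated_cvg_EFin _ _ _ P (fun n w => expR_dq n (X w) ^+ 2)
  (fun w => X w ^+ 2) (fun w => expR (4 * X w) + expR (- 4 * X w)).
- move=> n; apply: measurable_funX; apply: measurable_funM => //.
  apply: measurable_funB => //; apply: measurableT_comp => //.
  exact: measurable_funM.
- by move=> w; rewrite expr2; under eq_fun do rewrite expr2; apply: cvgM; exact: expR_dq_cvg.
- by under eq_fun do rewrite EFinD; apply: integrableD => //; exact: ie.
- move=> n w; rewrite normrX.
  apply: (@le_trans _ _ ((expR `|X w| * expR `|X w|) ^+ 2)).
    rewrite ler_pXn2r ?nnegrE ?mulr_ge0 ?expR_ge0//.
    apply: (le_trans (expR_dq_le _ _)).
    by rewrite ler_wpM2r ?expR_ge0// normr_le_expR.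
  rewrite -expRD -expRM_natl.
  have -> : 2%:R * (`|X w| + `|X w|) = `|4 * X w| by rewrite normrM ger0_norm//; ring.
  by rewrite mulNr expR_normr_le.
move=> _ _; set I := (\int[P]_x _)%E => cI.
(* The Laplace transform is quadratic in the exponent, so the means are again difference quotients,
   with step [1 / n.+1 ^ 2 = 1 / (k n).+1]. *)
pose k n := ((n.+1 ^ 2).-1)%N.
have Ik n : (\int[P]_w (expR_dq n (X w) ^+ 2)%:E)%E
   = (expR_dq (k n) (2 * v) - 2 * expR_dq (k n) (v / 2))%:E.
  set N : R := n.+1%:R; have N0 : N != 0 by rewrite /N pnatr_eq0.
  transitivity (\int[P]_w ((N ^+ 2 * expR (2 / N * X w))%:E
     - (2 * N ^+ 2 * expR (N^-1 * X w))%:E + (N ^+ 2)%:E))%E.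
    apply: eq_integral => w _; rewrite -EFinN -!EFinD; congr EFin.
    rewrite /expR_dq -/N exprMn (_ : 2 / N * X w = 2%:R * (X w / N)); last by field.
    rewrite expRM_natl (mulrC N^-1); ring.
  have i1 a b : P.-integrable setT (fun w => (b * expR (a * X w))%:E).
    by under eq_fun do rewrite EFinM; apply: integrableZl => //; exact: ie.
  have i3 : P.-integrable setT (fun w : T => (N ^+ 2)%:E).
    exact: finite_measure_integrable_cst.
  rewrite integralD//; last by apply: integrableB => //; exact: i1.
  rewrite integralB//.
  have Ii a b : (\int[P]_w (b * expR (a * X w))%:E = (b * expR (a ^+ 2 * v / 2))%:E)%E.
    under eq_integral do rewrite EFinM.
    by rewrite integralZl// (centered_gaussian_mgf gX) EFinM.
  rewrite !Ii integral_cst//= probability_setT mule1.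
  rewrite -?EFinN -?EFinD; congr EFin.
  have NE : (k n).+1%:R = N ^+ 2 by rewrite /k prednK ?expn_gt0// natrX.
  rewrite /expR_dq NE.
  rewrite (_ : (2 / N) ^+ 2 * v / 2 = 2 * v / N ^+ 2); last by field.
  rewrite (_ : N^-1 ^+ 2 * v / 2 = v / 2 / N ^+ 2); last by field.
  ring.
have ck (y : R) : expR_dq (k n) y @[n --> \oo] --> y.
  have ky : k n @[n --> \oo] --> \oo.
    apply/cvgnyPge => A; near=> n.
    apply: (@leq_trans n); first by near: n; exact: nbhs_infty_ge.
    by rewrite /k -subn1 leq_subRL ?expn_gt0// add1n expnS expn1 leq_pmulr.
  exact: (cvg_comp _ _ ky (@expR_dq_cvg R y)).
apply/esym/(cvg_unique (@ereal_hausdorff R) _ cI).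
rewrite (_ : (fun n => _) = (fun n => (expR_dq (k n) (2 * v) - 2 * expR_dq (k n) (v / 2))%:E)).
  apply: cvg_EFin; first exact: nearW.
  rewrite [X in _ --> X](_ : _ = 2 * v - 2 * (v / 2)); last by field.
  by apply: cvgB; [exact: ck|apply: cvgMl_tmp; exact: ck].
by apply/funext => n; exact: Ik.
Unshelve. all: end_near. Qed.

(** Entries are pairs (coefficient, time). Times may repeat, so that concatenation of lists is
    addition. *)
Definition lincomb (R : realType) (T : Type) (X : R -> T -> R) (l : seq (R * R)) (w : T) : R :=
  \sum_(p <- l) p.1 * X p.2 w.

Section fbm_moments.
Context d (T : measurableType d) (R : realType) (P : probability T R).
Variables (H : R) (W : R -> T -> R).
Hypothesis hW : is_fBM P H W.

Definition fbm_var (t : R) : R := `|t| `^ (2 * H).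
Local Notation f := fbm_var.
Definition fbm_cov (s t : R) : R := (f s + f t - f (s - t)) / 2.
Local Notation K := fbm_cov.

Lemma fbm_var_ge0 t : 0 <= f t. Proof. exact: powR_ge0. Qed.

Lemma fbm_varN t : f (- t) = f t. Proof. by rewrite /f normrN. Qed.

Lemma fbm_varBC s t : f (s - t) = f (t - s). Proof. by rewrite -fbm_varN opprB. Qed.

Lemma fbm_lincomb_gaussian l : exists v, centered_gaussian P (lincomb W l) v.
Proof.
case: hW => /(_ (size l) (fun i => (nth (0, 0) l i).2) (fun i => (nth (0,0) l i).1)) [v gv] _ _ _.
exists v; rewrite (_ : lincomb W l = fun w => \sum_(i < size l)
   (nth (0,0) l i).1 * W (nth (0,0) l i).2 w)//.
by apply/funext => w; rewrite /lincomb (big_nth (0,0)) big_mkord.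
Qed.

Lemma measurable_fbm_lincomb l : measurable_fun setT (lincomb W l).
Proof. by have [v []] := fbm_lincomb_gaussian l. Qed.

Lemma measurable_fbm t : measurable_fun setT (W t).
Proof.
have := measurable_fbm_lincomb [:: (1, t)].
by rewrite (_ : lincomb _ _ = W t)//; apply/funext => w; rewrite /lincomb big_seq1 mul1r.
Qed.

Lemma fbm_increment_sqr s t : (\int[P]_w ((W s w - W t w) ^+ 2)%:E = (f (s - t))%:E)%E.
Proof. by case: hW => _ _ _ /(_ s t); rewrite unlock. Qed.

Lemma fbm0 w : W 0 w = 0. Proof. by case: hW. Qed.

Lemma fbm_continuous w : continuous (fun t => W t w). Proof. by case: hW. Qed.

(** Polarisation: as [W 0 = 0], each product [W s * W t] is a combination of squared increments, and
    the means of those are what [is_fBM] provides. *)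
Lemma fbm_lincomb_sqr l : (\int[P]_w (lincomb W l w ^+ 2)%:E =
  (\sum_(p <- l) \sum_(q <- l) p.1 * q.1 * K p.2 q.2)%:E)%E.
Proof.
pose D s t w := (W s w - W t w) ^+ 2.
have iD s t : P.-integrable setT (fun w => (D s t w)%:E).
  apply/integrableP; split.
    apply/measurable_EFinP; apply: measurable_funX; apply: measurable_funB; exact: measurable_fbm.
  under eq_integral do rewrite gee0_abs ?lee_fin ?sqr_ge0//.
  by rewrite fbm_increment_sqr ltry.
pose g (p q : R * R) w := ((p.1 * q.1 / 2)%:E * ((D p.2 0 w)%:E + (D q.2 0 w)%:E - (D p.2 q.2 w)%:E))%E.
have ig p q : P.-integrable setT (g p q).
  by apply: integrableZl => //; apply: integrableB => //; apply: integrableD.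
have Ig p q : (\int[P]_w g p q w)%E = (p.1 * q.1 * K p.2 q.2)%:E.
  rewrite integralZl//; last by apply: integrableB => //; apply: integrableD.
  rewrite integralB//; last exact: integrableD.
  rewrite integralD// /D !fbm_increment_sqr !subr0 -!(EFinD, EFinN) -EFinM.
  by congr EFin; rewrite /K; field.
transitivity (\int[P]_w (\sum_(p <- l) \sum_(q <- l) g p q w))%E.
  apply: eq_integral => w _; rewrite expr2 /lincomb mulr_suml -sumEFin.
  apply: eq_bigr => p _; rewrite mulr_sumr -sumEFin; apply: eq_bigr => q _.
  rewrite /g /D fbm0 -EFinN -!EFinD -EFinM; congr EFin.
  by field.
rewrite integral_sum//; last by move=> p; apply: integrable_sum.
rewrite -sumEFin; apply: eq_bigr => p _; rewrite integral_sum//.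
by rewrite -sumEFin; apply: eq_bigr => q _; exact: Ig.
Qed.

Lemma fbm_expR_lincomb l : (\int[P]_w (expR (lincomb W l w))%:E =
  (expR ((\sum_(p <- l) \sum_(q <- l) p.1 * q.1 * K p.2 q.2) / 2))%:E)%E.
Proof.
have [v gv] := fbm_lincomb_gaussian l.
have := centered_gaussian_sqr gv; rewrite fbm_lincomb_sqr => -[->].
have := centered_gaussian_mgf gv 1; rewrite expr1n mul1r => <-.
by apply: eq_integral => w _; rewrite mul1r.
Qed.

End fbm_moments.

(** * Laplace transforms and equality of laws *)

Section lincomb_theory.
Context (R : realType) (T : Type) (X : R -> T -> R).

Lemma lincomb_cat l1 l2 w : lincomb X (l1 ++ l2) w = lincomb X l1 w + lincomb X l2 w.
Proof. by rewrite /lincomb big_cat. Qed.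

Lemma lincomb1 c t w : lincomb X [:: (c, t)] w = c * X t w.
Proof. by rewrite /lincomb big_seq1. Qed.

End lincomb_theory.

Lemma measurable_lincomb d (T : measurableType d) (R : realType) (X : R -> T -> R) l :
  (forall t, measurable_fun setT (X t)) -> measurable_fun setT (lincomb X l).
Proof.
move=> mX; rewrite (_ : lincomb X l = fun w => \sum_(p <- l) (fun p w => p.1 * X p.2 w) p w)//.
apply: measurable_sum => p; exact: measurable_funM.
Qed.

Section sin_series.
Context {R : realType}.

Lemma sin_series_le (y : R) n : `|series (sin_coeff y) n| <= expR `|y|.
Proof.
apply: (@le_trans _ _ (series (exp_coeff `|y|) n)).
  rewrite /series/=; apply: le_trans (ler_norm_sum _ _ _) _.
  apply: ler_sum => k _; rewrite /sin_coeff /exp_coeff /=.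
  rewrite !normrM normfV !normr_nat !normrX normrN normr1 expr1n mulr1.
  by case: odd; rewrite ?mul1r// !mul0r divr_ge0.
rewrite /expR; apply: nondecreasing_cvgn_le; last exact: is_cvg_series_exp_coeff.
apply/nondecreasing_seqP => k; rewrite seriesSr lerDl/= /exp_coeff.
by rewrite /= divr_ge0.
Qed.

Lemma sin_series_cvg (y : R) : series (sin_coeff y) n @[n --> \oo] --> sin y.
Proof. by rewrite unlock; exact: is_cvg_series_sin_coeff. Qed.

End sin_series.

Section sign_iteration.
Context {R : realType}.

(* The odd cubic fixing -1, 0, 1 and attracting ]0, 1] to 1: its iterates are
   polynomials converging boundedly to the sign function on [-1, 1]. *)
Definition sign_step (y : R) : R := (3 * y - y ^+ 3) / 2.

Lemma iter_sign_step_le1 k (y : R) : `|y| <= 1 -> `|iter k sign_step y| <= 1.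
Proof.
move=> y1; elim: k => // k; rewrite iterS; move: (iter _ _ _) => z.
rewrite !ler_norml /sign_step => /andP[z1 z2].
(* [1 - sign_step z] has a double root at [1], and [1 + sign_step z] one at [-1]. *)
have h1 : 0 <= (1 - z) ^+ 2 * (2 + z) by rewrite mulr_ge0 ?sqr_ge0//; lra.
have h2 : 0 <= (1 + z) ^+ 2 * (2 - z) by rewrite mulr_ge0 ?sqr_ge0//; lra.
have e1 : (1 - z) ^+ 2 * (2 + z) = 2 - (3 * z - z ^+ 3) by ring.
have e2 : (1 + z) ^+ 2 * (2 - z) = 2 + (3 * z - z ^+ 3) by ring.
by apply/andP; split; lra.
Qed.

Lemma iter_sign_stepN k (y : R) : iter k sign_step (- y) = - iter k sign_step y.
Proof.
elim: k => // k; rewrite !iterS => ->; rewrite /sign_step.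
by field.
Qed.

(** Each step multiplies the gap to [1] by [1 - (z + z ^+ 2) / 2]. Iterates stay above the starting
    point [y], so this factor is at most [1 - y / 2] and the convergence is geometric. *)
Lemma iter_sign_step_pos k (y : R) : 0 < y <= 1 ->
  y <= iter k sign_step y <= 1 /\ 1 - iter k sign_step y <= (1 - y / 2) ^+ k.
Proof.
move=> /andP[y0 y1]; elim: k => [|k]; first by rewrite /= expr0 lexx y1; split => //; lra.
rewrite iterS exprSr; move: (iter _ _ _) => z [/andP[yz z1] hz].
have E : 1 - sign_step z = (1 - z) * (1 - (z + z ^+ 2) / 2) by rewrite /sign_step; field.
have z2 : z ^+ 2 <= 1 by rewrite expr2; nra.
have z20 : 0 <= z ^+ 2 by exact: sqr_ge0.
have h : 1 - sign_step z <= (1 - z) * (1 - y / 2).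
  by rewrite E ler_wpM2l; lra.
split; last by apply: le_trans h _; rewrite ler_wpM2r//; lra.
have h0 : 0 <= 1 - sign_step z by rewrite E mulr_ge0; lra.
have h3 : 1 - sign_step z <= 1 - z by apply: le_trans h _; rewrite ler_piMr; lra.
by apply/andP; split; lra.
Qed.

Lemma iter_sign_step_cvg (y : R) : `|y| <= 1 -> iter k sign_step y @[k --> \oo] --> Num.sg y.
Proof.
have pos (z : R) : 0 < z <= 1 -> iter k sign_step z @[k --> \oo] --> (1 : R).
  move=> z01; have /andP[z0 z1] := z01.
  apply/cvgrPdist_le => e e0.
  have /cvgrPdist_le/(_ _ e0) : (1 - z / 2) ^+ k @[k --> \oo] --> (0:R).
    by apply: cvg_expr; rewrite ger0_norm; lra.
  apply: filterS => k; rewrite sub0r normrN => hk.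
  have [/andP[_ h1] h2] := iter_sign_step_pos k z01.
  rewrite ger0_norm; last by rewrite subr_ge0.
  exact: le_trans h2 (le_trans (ler_norm _) hk).
rewrite ler_norml => /andP[y1 y2]; have [y0|y0|->] := ltgtP y 0.
- rewrite ltr0_sg// -(opprK y); under eq_fun do rewrite iter_sign_stepN.
  by apply: cvgN; apply: pos; lra.
- by rewrite gtr0_sg//; apply: pos; rewrite y0.
- rewrite sgr0 (_ : (fun k => _) = cst 0); first exact: cvg_cst.
  by apply/funext; elim=> // k /= ->; rewrite /sign_step; field.
Qed.

Lemma sg_sin_cvg (y : R) : Num.sg (sin (y / n.+1%:R)) @[n --> \oo] --> Num.sg y.
Proof.
have pos (z : R) : 0 < z -> \forall n \near \oo, Num.sg (sin (z / n.+1%:R)) = 1.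
  move=> z0; near=> n.
  rewrite gtr0_sg// sin2_gt0// divr_gt0//= ltr_pdivrMr// mulrC -ltr_pdivrMr//.
  apply: (@lt_trans _ _ n%:R); last by rewrite ltr_nat.
  by near: n; exact: nbhs_infty_gtr.
apply: cvg_near_cst; have [y0|y0|->] := ltgtP y 0.
- have : 0 < - y by lra.
  move=> /pos; apply: filterS => n; rewrite mulNr sinN sgrN (ltr0_sg y0).
  by move=> h; rewrite -(opprK (Num.sg _)) h.
- by rewrite gtr0_sg//; exact: pos.
- by apply: nearW => n; rewrite mul0r sin0.
Unshelve. all: end_near. Qed.

End sign_iteration.

Section laplace_pairs.
Context d (T : measurableType d) (R : realType) (P : probability T R).
(* Two processes, indexed by a boolean, are compared. *)
Variable X : bool -> R -> T -> R.
Hypothesis mX : forall b t, measurable_fun setT (X b t).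
Implicit Types g h G : bool -> T -> R.

(** Integrability against every exponential, so that the dominating functions below may themselves
    carry exponentials of the processes. *)
Definition laplace_integrable g := (forall b, measurable_fun setT (g b)) /\
  forall b l, P.-integrable setT (fun w => (g b w * expR (lincomb (X b) l w))%:E).

(** The weight is a variable, of any sign, so that test functions can be absorbed into it one factor
    at a time. *)
Definition same_laplace g := laplace_integrable g /\
  forall l, (\int[P]_w (g true w * expR (lincomb (X true) l w))%:E =
             \int[P]_w (g false w * expR (lincomb (X false) l w))%:E)%E.

Let mlin b l : measurable_fun setT (lincomb (X b) l).
Proof. exact: measurable_lincomb. Qed.

Let mexp b l : measurable_fun setT (fun w => expR (lincomb (X b) l w)).
Proof. exact: measurableT_comp. Qed.

Lemma laplace_integrable_le g G : (forall b, measurable_fun setT (g b)) ->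
  laplace_integrable G -> (forall b w, `|g b w| <= G b w) -> laplace_integrable g.
Proof.
move=> mg [mG iG] gG; split=> // b l; apply: le_integrable (iG b l) => //.
  by apply/measurable_EFinP; apply: measurable_funM.
move=> w _; rewrite !abse_EFin lee_fin !normrM ler_wpM2r//.
exact: le_trans (gG _ _) (ler_norm _).
Qed.

Lemma laplace_integrableD g h : laplace_integrable g -> laplace_integrable h ->
  laplace_integrable (fun b w => g b w + h b w).
Proof.
move=> [mg ig] [mh ih]; split=> [b|b l]; first exact: measurable_funD.
by under eq_fun do rewrite mulrDl EFinD; apply: integrableD.
Qed.

Lemma laplace_integrable_norm g : laplace_integrable g ->
  laplace_integrable (fun b w => `|g b w|).
Proof.
move=> [mg ig]; split=> [b|b l]; first exact: measurableT_comp.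
apply: le_integrable (ig b l) => //.
  by apply/measurable_EFinP; apply: measurable_funM => //; exact: measurableT_comp.
by move=> w _; rewrite !abse_EFin lee_fin !normrM normr_id.
Qed.

Lemma laplace_integrable_expR g c t a : laplace_integrable g ->
  laplace_integrable (fun b w => g b w * expR (c * (X b t w - a))).
Proof.
move=> [mg ig]; split=> [b|b l].
  apply: measurable_funM => //; apply: measurableT_comp => //.
  by apply: measurable_funM => //; apply: measurable_funB.
rewrite (_ : (fun w => _) = (fun w => (expR (- (c * a)))%:E *
   (g b w * expR (lincomb (X b) ((c, t) :: l) w))%:E)%E).
  exact: integrableZl.
apply/funext => w; rewrite -EFinM -cat1s lincomb_cat lincomb1 mulrBr !expRD; congr EFin.
ring.
Qed.

Lemma laplace_integrable_expR_norm g c t a : laplace_integrable g ->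
  laplace_integrable (fun b w => `|g b w| * expR `|c * (X b t w - a)|).
Proof.
move=> /laplace_integrable_norm ig.
apply: laplace_integrable_le (laplace_integrableD (laplace_integrable_expR c t a ig)
   (laplace_integrable_expR (- c) t a ig)) _.
  move=> b; apply: measurable_funM; first by case: ig.
  apply: measurableT_comp => //; apply: measurableT_comp => //.
  by apply: measurable_funM => //; apply: measurable_funB.
move=> b w /=; rewrite ger0_norm ?mulr_ge0 ?expR_ge0// -mulrDr ler_wpM2l//.
by rewrite mulNr expR_normr_le.
Qed.

Lemma eq_same_laplace g h : (forall b w, g b w = h b w) -> same_laplace g -> same_laplace h.
Proof. by move=> gh; rewrite (_ : g = h)//; apply/funext => b; apply/funext => w. Qed.

Lemma same_laplaceD g h : same_laplace g -> same_laplace h ->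
  same_laplace (fun b w => g b w + h b w).
Proof.
move=> [ig eg] [ih eh]; split=> [|l]; first exact: laplace_integrableD.
case: ig => _ ig; case: ih => _ ih.
under eq_integral do rewrite mulrDl EFinD.
rewrite integralD// eg eh -integralD//.
by apply: eq_integral => w _; rewrite mulrDl EFinD.
Qed.

Lemma same_laplaceZ k g : same_laplace g -> same_laplace (fun b w => k * g b w).
Proof.
move=> [[mg ig] eg]; split=> [|l].
  split=> [b|b l]; first exact: measurable_funM.
  by under eq_fun do rewrite -mulrA EFinM; apply: integrableZl.
under eq_integral do rewrite -mulrA EFinM.
rewrite integralZl// eg -integralZl//.
by apply: eq_integral => w _; rewrite -mulrA EFinM.
Qed.

Lemma same_laplace_expR c t a g : same_laplace g ->
  same_laplace (fun b w => g b w * expR (c * (X b t w - a))).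
Proof.
move=> [ig eg]; split=> [|l]; first exact: laplace_integrable_expR.
have E b w : g b w * expR (c * (X b t w - a)) * expR (lincomb (X b) l w) =
   expR (- (c * a)) * (g b w * expR (lincomb (X b) ((c, t) :: l) w)).
  by rewrite -cat1s lincomb_cat lincomb1 mulrBr !expRD; ring.
case: ig => _ ig.
under eq_integral do rewrite E EFinM.
rewrite integralZl// eg -integralZl//.
by apply: eq_integral => w _; rewrite E EFinM.
Qed.

Lemma same_laplace_cvg (g_ : nat -> bool -> T -> R) g G :
  (forall n, same_laplace (g_ n)) -> laplace_integrable G ->
  (forall b w, g_ n b w @[n --> \oo] --> g b w) ->
  (forall n b w, `|g_ n b w| <= G b w) -> same_laplace g.
Proof.
move=> sg [mG iG] cg gG.
have key b l := @dominated_cvg_EFin _ _ _ P (fun n w => g_ n b w * expR (lincomb (X b) l w))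
  (fun w => g b w * expR (lincomb (X b) l w)) (fun w => G b w * expR (lincomb (X b) l w)).
have {}key b l : P.-integrable setT (fun w => (g b w * expR (lincomb (X b) l w))%:E) /\
   (\int[P]_w (g_ n b w * expR (lincomb (X b) l w))%:E @[n --> \oo] -->
   \int[P]_w (g b w * expR (lincomb (X b) l w))%:E)%E.
  have [] := key b l.
  - by move=> n; have [[mg _] _] := sg n; apply: measurable_funM.
  - by move=> w; apply: cvgM; [exact: cg|exact: cvg_cst].
  - exact: iG.
  - by move=> n w; rewrite normrM (ger0_norm (expR_ge0 _)) ler_wpM2r ?expR_ge0.
  by [].
split=> [|l].
  split=> b; last by move=> l; have [] := key b l.
  apply: (@measurable_fun_cvg _ _ _ _ (fun n => g_ n b)) => //.
  by move=> n; have [[mg _] _] := sg n; exact: mg.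
have [_ c1] := key true l; have [_ c2] := key false l.
move: c1; rewrite (_ : (fun n => _) = (fun n => \int[P]_w (g_ n false w * expR (lincomb (X false) l w))%:E)%E).
  by move=> c1; exact: (cvg_unique (@ereal_hausdorff R) c1 c2).
by apply/funext => n; exact: (sg n).2.
Qed.

Lemma same_laplace_mulX c t a g : same_laplace g ->
  same_laplace (fun b w => g b w * (c * (X b t w - a))).
Proof.
move=> sg; pose Y b w := c * (X b t w - a).
(* The factor [2] in the dominating function comes from [|y| exp |y| <= exp |2 y|]. *)
apply: (@same_laplace_cvg (fun n b w => g b w * expR_dq n (Y b w)) _
   (fun b w => `|g b w| * expR `|2 * c * (X b t w - a)|)).
- move=> n; set N : R := n.+1%:R.
  have s1 := same_laplaceZ N (same_laplace_expR (c / N) t a sg).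
  apply: eq_same_laplace (same_laplaceD s1 (same_laplaceZ (- N) sg)) => b w.
  rewrite /expR_dq /Y -/N (_ : c / N * _ = c * (X b t w - a) / N); last by rewrite mulrAC.
  by ring.
- by apply: laplace_integrable_expR_norm; case: sg.
- by move=> b w; apply: cvgMl_tmp; exact: expR_dq_cvg.
- move=> n b w; rewrite normrM ler_wpM2l//.
  apply: (le_trans (expR_dq_le _ _)).
  have -> : `|2 * c * (X b t w - a)| = `|Y b w| + `|Y b w|.
    by rewrite -mulrA (normrM 2) ger0_norm// -/(Y b w); ring.
  rewrite expRD.
  by rewrite ler_wpM2r ?expR_ge0// normr_le_expR.
Qed.

Lemma same_laplace_mulXn c t a k g : same_laplace g ->
  same_laplace (fun b w => g b w * (c * (X b t w - a)) ^+ k).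
Proof.
move=> sg; elim: k => [|k ih].
  by apply: eq_same_laplace sg => b w; rewrite expr0 mulr1.
by apply: eq_same_laplace (same_laplace_mulX c t a ih) => b w; rewrite exprSr -[LHS]mulrA.
Qed.

Lemma same_laplace_sin c t a g : same_laplace g ->
  same_laplace (fun b w => g b w * sin (c * (X b t w - a))).
Proof.
move=> sg.
apply: (@same_laplace_cvg (fun n b w => g b w * series (sin_coeff (c * (X b t w - a))) n) _
   (fun b w => `|g b w| * expR `|c * (X b t w - a)|)).
- elim=> [|n ih].
    by apply: eq_same_laplace (same_laplaceZ 0 sg) => b w; rewrite /series/= big_geq// mulr0 mul0r.
  have s1 := same_laplaceZ ((odd n)%:R * (-1) ^+ n.-1./2 / n`!%:R) (same_laplace_mulXn c t a n sg).
  apply: eq_same_laplace (same_laplaceD ih s1) => b w.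
  by cbv beta; rewrite seriesSr [RHS]mulrDr; congr (_ + _); rewrite /sin_coeff /=; ring.
- by apply: laplace_integrable_expR_norm; case: sg.
- by move=> b w; apply: cvgMl_tmp; exact: sin_series_cvg.
- by move=> n b w; rewrite normrM ler_wpM2l// sin_series_le.
Qed.

(** Quantifying over all weights [g], not a fixed one, makes multipliers stable under products. *)
Definition multiplier h := [/\ forall b, measurable_fun setT (h b),
  exists M, forall b w, `|h b w| <= M &
  forall g, same_laplace g -> same_laplace (fun b w => g b w * h b w)].

Lemma eq_multiplier g h : (forall b w, g b w = h b w) -> multiplier g -> multiplier h.
Proof. by move=> gh; rewrite (_ : g = h)//; apply/funext => b; apply/funext => w. Qed.

Lemma multiplier_cst k : multiplier (fun b w => k).
Proof.
split=> //; first by exists `|k|.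
by move=> g /(same_laplaceZ k); apply: eq_same_laplace => b w; rewrite mulrC.
Qed.

Lemma multiplierD h1 h2 : multiplier h1 -> multiplier h2 -> multiplier (fun b w => h1 b w + h2 b w).
Proof.
move=> [m1 [M1 b1] s1] [m2 [M2 b2] s2]; split.
- by move=> b; exact: measurable_funD.
- by exists (M1 + M2) => b w; apply: le_trans (ler_normD _ _) _; exact: lerD.
- move=> g sg; apply: eq_same_laplace (same_laplaceD (s1 _ sg) (s2 _ sg)) => b w.
  by rewrite mulrDr.
Qed.

Lemma multiplierM h1 h2 : multiplier h1 -> multiplier h2 -> multiplier (fun b w => h1 b w * h2 b w).
Proof.
move=> [m1 [M1 b1] s1] [m2 [M2 b2] s2]; split.
- by move=> b; exact: measurable_funM.
- exists (M1 * M2) => b w; rewrite normrM; exact: ler_pM.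
- by move=> g sg; apply: eq_same_laplace (s2 _ (s1 _ sg)) => b w; rewrite mulrA.
Qed.

Lemma multiplierZ k h : multiplier h -> multiplier (fun b w => k * h b w).
Proof. exact/multiplierM/multiplier_cst. Qed.

Lemma multiplier_cvg (h_ : nat -> bool -> T -> R) h M :
  (forall n, multiplier (h_ n)) -> (forall n b w, `|h_ n b w| <= M) ->
  (forall b w, h_ n b w @[n --> \oo] --> h b w) -> multiplier h.
Proof.
move=> mh hM ch; split.
- move=> b; apply: (@measurable_fun_cvg _ _ _ _ (fun n => h_ n b)) => //.
  by move=> n; have [mg _ _] := mh n; exact: mg.
- exists M => b w.
  have cn : `|h_ n b w| @[n --> \oo] --> `|h b w| by apply: cvg_norm; exact: ch.
  rewrite -(cvg_lim (@norm_hausdorff _ _) cn); apply: limr_le; first exact: cvgP cn.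
  exact: nearW.
- move=> g sg.
  apply: (@same_laplace_cvg (fun n b w => g b w * h_ n b w) _ (fun b w => `|M * g b w|)).
  + by move=> n; have [_ _] := mh n; exact.
  + by apply: laplace_integrable_norm; case: (same_laplaceZ M sg).
  + by move=> b w; apply: cvgMl_tmp; exact: ch.
  + move=> n b w; rewrite !normrM mulrC ler_wpM2r//.
    exact: le_trans (hM _ _ _) (ler_norm _).
Qed.

Lemma multiplier_iter_sign k h : multiplier h ->
  multiplier (fun b w => iter k sign_step (h b w)).
Proof.
move=> mh; elim: k => // k ih.
have m3 := multiplierZ (- 2^-1) (multiplierM ih (multiplierM ih ih)).
apply: eq_multiplier (multiplierD (multiplierZ (3 / 2) ih) m3) => b w.
by rewrite iterS /sign_step; field.
Qed.

Lemma multiplier_sin c t a : multiplier (fun b w => sin (c * (X b t w - a))).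
Proof.
split.
- move=> b; apply: measurableT_comp.
    by apply: continuous_measurable_fun; exact: continuous_sin.
  by apply: measurable_funM => //; apply: measurable_funB.
- by exists 1 => b w; exact: sin_max.
- by move=> g; exact: same_laplace_sin.
Qed.

(** Two nested limits: iterating [sign_step] turns the sine into its sign, then letting the
    frequency [1 / n.+1] tend to [0] removes the periodicity, since the sine has the sign of its
    argument on []-2, 2[]. *)
Lemma multiplier_sg t a : multiplier (fun b w => Num.sg (X b t w - a)).
Proof.
apply: (@multiplier_cvg (fun n b w => Num.sg (sin ((X b t w - a) / n.+1%:R))) _ 1).
- move=> n; apply: (@multiplier_cvg (fun k b w => iter k sign_step (sin (n.+1%:R^-1 * (X b t w - a)))) _ 1).
  + by move=> k; exact/multiplier_iter_sign/multiplier_sin.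
  + by move=> k b w; apply: iter_sign_step_le1; exact: sin_max.
  + by move=> b w; rewrite (mulrC _ n.+1%:R^-1); apply: iter_sign_step_cvg; exact: sin_max.
- by move=> n b w; rewrite normr_sg; case: (_ != 0); rewrite ?ler01.
- by move=> b w; exact: sg_sin_cvg.
Qed.

Lemma multiplier_gt t a : multiplier (fun b w => \1_[set w | a < X b t w] w).
Proof.
have s := multiplier_sg t a.
(* [s (s + 1) / 2] is [1] at [s = 1] and vanishes at [s = 0] and [s = -1]. *)
have m2 := multiplierZ 2^-1 (multiplierM s (multiplierD s (multiplier_cst 1))).
apply: eq_multiplier m2 => b w.
rewrite indicE; have [h|h|h] := ltgtP a (X b t w).
- by rewrite mem_set// gtr0_sg ?subr_gt0// mulr1n; field.
- rewrite memNset/=; last by move=> /(lt_trans h); rewrite ltxx.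
  by rewrite ltr0_sg ?subr_lt0// addNr !mulr0.
- by rewrite memNset/= ?h ?ltxx// subrr sgr0 mul0r mulr0.
Qed.

End laplace_pairs.

(** * The space of continuous paths *)

(** Continuity is built into the points of the space: with the cylinder sigma-algebra it makes
    evaluation jointly measurable in path and time, hence time integrals are measurable functionals
    of the path. *)
Record cpath (R : realType) := CPath {
  cpath_fun :> R -> R ;
  cpath_continuous : continuous cpath_fun }.

HB.instance Definition _ (R : realType) := gen_eqMixin (cpath R).
HB.instance Definition _ (R : realType) := gen_choiceMixin (cpath R).
HB.instance Definition _ (R : realType) :=
  isPointed.Build (cpath R) (CPath (@cst_continuous R R 0)).

Definition cylinder (R : realType) : set (set (cpath R)) :=
  [set A | exists t a : R, A = [set x : cpath R | a < x t]].

Definition cpath_space (R : realType) := g_sigma_algebraType (@cylinder R).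

Section path_space.
Context (R : realType).

Lemma measurable_cpath_eval (t : R) : measurable_fun setT (fun x : cpath_space R => (x : cpath R) t).
Proof.
apply: (measurability _ (RGenOInfty.measurableE R)) => //.
move=> _ [_ [a ->] <-]; rewrite setTI; apply: sub_sigma_algebra.
by exists t, a; apply/seteqP; split => x /=; rewrite in_itv/= andbT.
Qed.

Lemma measurable_cpath_joint :
  measurable_fun setT (fun p : cpath_space R * R => (p.1 : cpath R) p.2).
Proof.
apply: (@measurable_fun_continuous_process _ (cpath_space R) R (fun t x => (x : cpath R) t)).
  exact: measurable_cpath_eval.
by move=> x; exact: cpath_continuous.
Qed.

Context d (T : measurableType d) (P : probability T R).
Variable X : bool -> R -> T -> R.
Hypothesis mX : forall b t, measurable_fun setT (X b t).
Hypothesis cX : forall b w, continuous (fun t => X b t w).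

Definition path_of b (w : T) : cpath_space R := CPath (@cX b w).

Lemma measurable_path_of b : measurable_fun setT (path_of b).
Proof.
apply: (@measurability _ _ _ _ setT (path_of b) (@cylinder R)) => //.
move=> _ [_ [t [a ->]] <-]; rewrite setTI.
have := mX b t; move=> /(_ measurableT `]a, +oo[%classic (measurable_itv _)).
rewrite setTI; congr (measurable _).
by apply/seteqP; split => x /=; rewrite in_itv/= andbT.
Qed.

(** The sets whose indicator is a multiplier contain the cylinders. Products give intersections,
    differences give complements and bounded limits give countable unions, so these sets form a
    sigma-algebra. *)
Lemma multiplier_path (A : set (cpath_space R)) : measurable A ->
  multiplier P X (fun b w => \1_A (path_of b w)).
Proof.
pose C := [set A | multiplier P X (fun b w => \1_A (path_of b w))].
suff : <<s @cylinder R >> `<=` C by apply.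
apply: smallest_sub; last first.
  move=> _ [t [a ->]]; apply: eq_multiplier (multiplier_gt P mX t a) => b w.
  by rewrite !indicE; congr (_%:R); congr nat_of_bool; apply/idP/idP => /set_mem h; apply/mem_set.
have CC B : C B -> C (~` B).
  move=> CB; have := multiplierD (multiplier_cst P X 1) (multiplierZ (- 1) CB).
  apply: eq_multiplier => b w; rewrite !indicE in_setC.
  by case: (_ \in B) => /=; rewrite ?mulr1 ?mulr0 ?subrr ?addr0.
have CI B1 B2 : C B1 -> C B2 -> C (B1 `&` B2).
  move=> C1 C2; have := multiplierM C1 C2.
  by apply: eq_multiplier => b w; rewrite indicI.
have CU B1 B2 : C B1 -> C B2 -> C (B1 `|` B2).
  move=> C1 C2; rewrite -(setCK (_ `|` _)) setCU; apply: (CC); apply: CI; exact: CC.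
have C0 : C set0.
  by apply: eq_multiplier (multiplier_cst P X 0) => b w; rewrite indic0.
split => //.
  by move=> B CB; rewrite setTD; exact: CC.
move=> F CF.
have CF' n : C (\big[setU/set0]_(k < n) F k).
  elim: n => [|n ih]; first by rewrite big_ord0.
  by rewrite big_ord_recr/=; exact: CU.
apply: (@multiplier_cvg _ _ _ P _ mX (fun n b w => \1_(\big[setU/set0]_(k < n) F k) (path_of b w)) _ 1).
- exact: CF'.
- by move=> n b w; rewrite indicE ger0_norm//; case: (_ \in _) => /=; rewrite ?ler01.
- move=> b w; apply: cvg_near_cst; set x := path_of b w.
  have [[m _ Fm]|nF] := pselect ((\bigcup_n F n) x).
    near=> n; rewrite !indicE !mem_set//; first by exists m.
    rewrite -bigcup_mkord; exists m => //=.
    by near: n; exact: nbhs_infty_gt.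
  apply: nearW => n; rewrite !indicE !memNset// -bigcup_mkord => -[k _ Fk].
  by apply: nF; exists k.
Unshelve. all: end_near. Qed.

Lemma same_laplace_integral (g : bool -> T -> R) (F : cpath_space R -> R) :
  same_laplace P X g -> (forall b w, 0 <= g b w) ->
  measurable_fun setT F -> (forall x, 0 <= F x) ->
  (\int[P]_w (g true w * F (path_of true w))%:E =
   \int[P]_w (g false w * F (path_of false w))%:E)%E.
Proof.
move=> sg g0 mF F0; have [[mg _] _] := sg.
apply: (ge0_integral_transfer (measurable_path_of true) (measurable_path_of false)
  (mg true) (mg false) (g0 true) (g0 false)) => //.
(* At the empty combination the Laplace transform is the total mass of the weight [g b * \1_A]. *)
move=> A mA; have [_ _ /(_ _ sg)[_ /(_ [::])]] := multiplier_path mA.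
have E b : (\int[P]_w (g b w * \1_A (path_of b w) * expR (lincomb (X b) [::] w))%:E =
            \int[P]_w (g b w * \1_A (path_of b w))%:E)%E.
  by apply: eq_integral => w _; rewrite /lincomb big_nil expR0 mulr1.
by rewrite !E.
Qed.

End path_space.

(** * Change of measure for fractional Brownian motion *)

Section fbm_var_theory.
Context (R : realType) (H : R).
Local Notation f := (fbm_var H).

(** The power of exponent zero is one even at base zero, hence the hypothesis. *)
Lemma fbm_var0 : H != 0 -> f 0 = 0.
Proof. by move=> H0; rewrite /fbm_var normr0 powR0// mulf_neq0. Qed.

Lemma fbm_var_continuous : 0 < H -> continuous f.
Proof.
move=> H0 t; have [->|t0] := eqVneq t 0.
  rewrite /continuous_at (fbm_var0 (lt0r_neq0 H0)).
  apply/cvgrPdist_le => e e0; near=> x.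
  rewrite sub0r normrN ger0_norm ?fbm_var_ge0// /fbm_var.
  have -> : e = (e `^ (2 * H)^-1) `^ (2 * H).
    by rewrite -powRrM mulVf ?powRr1 ?ltW// mulf_neq0// lt0r_neq0.
  apply: ge0_ler_powR; rewrite ?nnegrE ?powR_ge0//; first by rewrite mulr_ge0// ltW.
  near: x; apply: cvgr0_norm_le; [exact: cvg_id|exact: powR_gt0].
have E x : x != 0 -> f x = expR (2 * H * ln `|x|).
  by move=> x0; rewrite /fbm_var /powR normr_eq0 (negbTE x0).
rewrite /continuous_at (E _ t0).
apply: cvg_trans; first apply: (@near_eq_cvg _ _ _ _ (fun x => expR (2 * H * ln `|x|))).
  by near=> x; rewrite E//; near: x; apply: cvgr_neq0 t0; exact: cvg_id.
apply: continuous_cvg; first exact: continuous_expR.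
apply: cvgMl_tmp.
apply: (@continuous_cvg _ _ _ _ _ (fun x : R => `|x|)).
  by apply: continuous_ln; rewrite normr_gt0.
by apply: cvg_norm; exact: cvg_id.
Unshelve. all: end_near. Qed.

End fbm_var_theory.

Section fbm_tilt.
Context d (T : measurableType d) (R : realType) (P : probability T R).
Variables (H : R) (W : R -> T -> R).
Hypothesis H0 : 0 < H.
Hypothesis hW : is_fBM P H W.
Local Notation f := (fbm_var H).
Local Notation K := (fbm_cov H).
Local Notation Z := (Zproc H W).

Lemma ZprocE t w : Z t w = expR (W t w - f t / 2). Proof. by []. Qed.

Definition log_Zproc (t : R) (w : T) : R := W t w - f t / 2.

Lemma measurable_log_Zproc t : measurable_fun setT (log_Zproc t).
Proof. by apply: measurable_funB => //; exact: (measurable_fbm hW). Qed.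

Lemma log_Zproc_continuous w : continuous (fun t => log_Zproc t w).
Proof.
move=> t; apply: cvgB; first exact: (fbm_continuous hW).
apply: cvgMr_tmp; exact: fbm_var_continuous.
Qed.

Variable t : R.

Definition reversed_log_ratio (b : bool) (s : R) (w : T) : R :=
  if b then log_Zproc (t - s) w - log_Zproc t w else log_Zproc s w.
Local Notation X := reversed_log_ratio.

Lemma measurable_reversed_log_ratio b s : measurable_fun setT (X b s).
Proof.
case: b; last exact: measurable_log_Zproc.
by apply: measurable_funB; exact: measurable_log_Zproc.
Qed.

Lemma reversed_log_ratio_continuous b w : continuous (fun s => X b s w).
Proof.
case: b; last exact: log_Zproc_continuous.
move=> s; apply: cvgB; last exact: cvg_cst.
apply: (@continuous_cvg _ _ _ _ _ (fun s : R => t - s) (fun s => log_Zproc s w)).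
  exact: log_Zproc_continuous.
by apply: cvgB; [exact: cvg_cst|exact: cvg_id].
Qed.

(** The terms depending on one index factor through the sum of the coefficients, and only the
    increment term [D] stays a double sum. In the change of measure that double sum is the same on
    both sides. *)
Lemma sum_cov_type (l : seq (R * R)) (a : R * R -> R) (D : R * R -> R * R -> R) :
  \sum_(p <- l) \sum_(q <- l) p.1 * q.1 * ((a p + a q - D p q) / 2) =
  (\sum_(p <- l) p.1) * (\sum_(p <- l) p.1 * a p)
  - (\sum_(p <- l) \sum_(q <- l) p.1 * q.1 * D p q) / 2.
Proof.
transitivity (2^-1 * ((\sum_(p <- l) p.1 * a p) * (\sum_(q <- l) q.1)) +
   2^-1 * ((\sum_(p <- l) p.1) * (\sum_(q <- l) q.1 * a q)) -
   (\sum_(p <- l) \sum_(q <- l) p.1 * q.1 * D p q) / 2); last by field.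
rewrite mulr_suml (mulr_suml _ _ _ (\sum_(q <- l) q.1 * a q)) !mulr_sumr mulr_suml.
rewrite -sumrN -!big_split/=; apply: eq_bigr => p _.
rewrite !mulr_sumr mulr_suml -sumrN -!big_split/=; apply: eq_bigr => q _.
by field.
Qed.

Definition tilt_density (b : bool) (w : T) : R := if b then Z t w else 1.

Lemma same_laplace_tilt : same_laplace P X tilt_density.
Proof.
pose C (l : seq (R * R)) : R := \sum_(p <- l) p.1.
(* Both integrands become a constant [expR (k_ b l)] times the exponential of a linear combination
   [l_ b l] of [W]. In the case [true] the weight [Z t] and the subtracted [log_Zproc t] give [W t]
   the coefficient [1 - C l]. *)
pose l_ (b : bool) (l : seq (R * R)) :=
  if b then (1 - C l, t) :: [seq (p.1, t - p.2) | p <- l] else l.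
pose k_ (b : bool) (l : seq (R * R)) := if b
  then - f t / 2 - (\sum_(p <- l) p.1 * f (t - p.2)) / 2 + C l * f t / 2
  else - (\sum_(p <- l) p.1 * f p.2) / 2.
have E b l w : tilt_density b w * expR (lincomb (X b) l w) =
    expR (k_ b l) * expR (lincomb W (l_ b l) w).
  case: b; rewrite /tilt_density /k_ /l_ -expRD.
    rewrite ZprocE -expRD; congr expR.
    rewrite {2}/lincomb big_cons big_map /= /lincomb /=.
    under eq_bigr do rewrite /log_Zproc !mulrBr.
    rewrite !sumrB -!mulr_suml -/(C l).
    have -> : \sum_(p <- l) p.1 * (f (t - p.2) / 2) = (\sum_(p <- l) p.1 * f (t - p.2)) / 2.
      by rewrite mulr_suml; apply: eq_bigr => p _; rewrite mulrA.
    by field.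
  rewrite mul1r; congr expR; rewrite /lincomb /=.
  under eq_bigr do rewrite /log_Zproc mulrBr.
  rewrite sumrB addrC mulNr mulr_suml; congr (- _ + _).
  by apply: eq_bigr => p _; rewrite mulrA.
have ie l : P.-integrable setT (fun w => (expR (lincomb W l w))%:E).
  apply/integrableP; split.
    by apply/measurable_EFinP; apply: measurableT_comp => //; exact: (measurable_fbm_lincomb hW).
  under eq_integral do rewrite gee0_abs ?lee_fin ?expR_ge0//.
  by rewrite (fbm_expR_lincomb hW) ltry.
split.
  split=> [b|b l].
    case: b; last exact: measurable_cst.
    have h : measurable_fun setT (fun w => expR (log_Zproc t w)).
      by apply: measurableT_comp => //; exact: measurable_log_Zproc.
    exact: h.
  by under eq_fun do rewrite E EFinM; apply: integrableZl.
move=> l.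
have I b : (\int[P]_w (tilt_density b w * expR (lincomb (X b) l w))%:E =
  (expR (k_ b l + (\sum_(p <- l_ b l) \sum_(q <- l_ b l) p.1 * q.1 * K p.2 q.2) / 2))%:E)%E.
  under eq_integral do rewrite E EFinM.
  by rewrite integralZl// (fbm_expR_lincomb hW) -EFinM -expRD.
rewrite !I; congr (expR _)%:E; rewrite /k_ /l_.
have f00 : f 0 = 0 by rewrite fbm_var0 ?gt_eqF.
rewrite big_cons /= big_cons /= !big_map /=.
under [X in _ + (_ + X) / 2]eq_bigr do rewrite big_cons big_map /=.
rewrite big_split/=.
have QE (a : R * R -> R) : \sum_(p <- l) \sum_(q <- l) p.1 * q.1 * K (a p) (a q) =
  C l * (\sum_(p <- l) p.1 * f (a p))
  - (\sum_(p <- l) \sum_(q <- l) p.1 * q.1 * f (a p - a q)) / 2.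
  exact: sum_cov_type.
rewrite (QE (fun p => t - p.2)) (QE (fun p => p.2)).
(* The variance of an increment is unchanged by the reflection [s |-> t - s]. *)
have -> : \sum_(p <- l) \sum_(q <- l) p.1 * q.1 * f (t - p.2 - (t - q.2)) =
   \sum_(p <- l) \sum_(q <- l) p.1 * q.1 * f (p.2 - q.2).
  apply: eq_bigr => p _; apply: eq_bigr => q _; congr (_ * _).
  by rewrite [LHS]fbm_varBC; congr (fbm_var H _); ring.
have -> : \sum_(p <- l) p.1 * (1 - C l) * K (t - p.2) t =
   \sum_(p <- l) (1 - C l) * p.1 * K t (t - p.2).
  apply: eq_bigr => p _; congr (_ * _); first by rewrite mulrC.
  by rewrite /K (fbm_varBC _ (t - p.2) t) (addrC (f t)).
have -> : \sum_(p <- l) (1 - C l) * p.1 * K t (t - p.2) =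
   (1 - C l) * (C l * f t + \sum_(p <- l) p.1 * f (t - p.2) - \sum_(p <- l) p.1 * f p.2) / 2.
  transitivity ((1 - C l) / 2 * (\sum_(p <- l) p.1 * f t +
     \sum_(p <- l) p.1 * f (t - p.2) - \sum_(p <- l) p.1 * f p.2)).
    rewrite -big_split/= -sumrB mulr_sumr; apply: eq_bigr => p _.
    by rewrite /K (_ : t - (t - p.2) = p.2); [field|ring].
  by rewrite -mulr_suml -/(C l); field.
rewrite /K subrr f00.
by field.
Qed.

Lemma fbm_tilt_integral (F : cpath_space R -> R) :
  measurable_fun setT F -> (forall x, 0 <= F x) ->
  (\int[P]_w (Z t w * F (path_of reversed_log_ratio_continuous true w))%:E =
   \int[P]_w (F (path_of reversed_log_ratio_continuous false w))%:E)%E.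
Proof.
move=> mF F0.
rewrite (@same_laplace_integral R _ _ P _ measurable_reversed_log_ratio
  reversed_log_ratio_continuous _ _ same_laplace_tilt _ mF F0).
  by apply: eq_integral => w _; rewrite mul1r.
by case=> w //; exact: expR_ge0.
Qed.

End fbm_tilt.

(** * Domination of the tilted densities *)

Section fbm_var_bounds.
Context (R : realType) (H : R).
Hypothesis hH : 1 / 2 <= H <= 1.
Local Notation f := (fbm_var H).

Let p1 : 1 <= 2 * H. Proof. by move: hH => /andP[h1 h2]; lra. Qed.
Let p2 : 2 * H <= 2. Proof. by move: hH => /andP[h1 h2]; lra. Qed.

Lemma fbm_var_le_sqr u x : 1 <= x -> `|u| <= x -> f u <= x ^+ 2.
Proof.
move=> x1 ux; apply: (@le_trans _ _ (x `^ (2 * H))).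
  by apply: ge0_ler_powR => //; [have := p1; lra|rewrite nnegrE; lra].
by rewrite -powR_mulrn; [apply: ler_powR|lra].
Qed.

Lemma fbm_var_ge_norm u : 1 <= `|u| -> `|u| <= f u.
Proof. by move=> u1; rewrite -{1}(@powRr1 _ `|u|)//; apply: ler_powR. Qed.

(** With [x = |u|] and [1 <= 2 H <= 2]: [(1 + 1/x)^{2H} <= (1 + 1/x)^2 <= 1 + 3/x]. The lower bound
    that follows rests likewise on [(1 - 2/x)^{2H} >= (1 - 2/x)^2 >= 1 - 4/x]. *)
Lemma fbm_var_shift_le u v : 1 <= `|u| -> `|v - u| <= 1 -> f v <= f u * (1 + 3 / `|u|).
Proof.
move=> u1 vu; set x := `|u|; have x0 : 0 < x by rewrite /x; lra.
have vx : `|v| <= x * (1 + x^-1).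
  rewrite mulrDr mulr1 divff ?gt_eqF//.
  by rewrite -{1}(subrK u v); apply: le_trans (ler_normD _ _) _; rewrite -/x; lra.
have /andP[ix0 ix1] : 0 < x^-1 <= 1 by rewrite invr_gt0 x0 invf_le1.
apply: (@le_trans _ _ ((x * (1 + x^-1)) `^ (2 * H))).
  by apply: ge0_ler_powR; rewrite ?nnegrE//; [have := p1; lra|apply: mulr_ge0; lra].
rewrite powRM; [|lra|lra].
rewrite ler_wpM2l ?powR_ge0//.
apply: (@le_trans _ _ ((1 + x^-1) ^+ 2)).
  by rewrite -powR_mulrn; [apply: ler_powR => //; lra|lra].
by nra.
Qed.

Lemma fbm_var_shift_ge u v : 2 <= `|u| -> `|v - u| <= 2 -> f u * (1 - 4 / `|u|) <= f v.
Proof.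
move=> u1 vu; set x := `|u|; have x0 : 0 < x by rewrite /x; lra.
have vx : x * (1 - 2 * x^-1) <= `|v|.
  rewrite mulrBr mulr1 mulrCA divff ?gt_eqF// mulr1.
  have : x <= `|v| + 2; last by lra.
  by rewrite /x -(subrK v u); apply: le_trans (ler_normD _ _) _; rewrite distrC; lra.
have /andP[ix0 ix1] : 0 < x^-1 <= 1 / 2.
  by rewrite invr_gt0 x0 -div1r ler_pdivrMr//= ; rewrite /x; lra.
apply: (@le_trans _ _ ((x * (1 - 2 * x^-1)) `^ (2 * H))); last first.
  by apply: ge0_ler_powR; rewrite ?nnegrE//; [have := p1; lra|apply: mulr_ge0; lra].
rewrite powRM; [|lra|lra].
rewrite ler_wpM2l ?powR_ge0//.
apply: (@le_trans _ _ ((1 - 2 * x^-1) ^+ 2)); first by nra.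
have [->|b0] := eqVneq (1 - 2 * x^-1) 0; first by rewrite expr0n powR_ge0.
rewrite -powR_mulrn; last by lra.
apply: ger_powR => //; rewrite lt_neqAle eq_sym b0 /=; apply/andP; split; lra.
Qed.

(* Logarithm of the mean of [Z_u Z_v^{-1/2} Z_r^{-1/2}]. *)
Definition kernel_exponent (u v r : R) := f (u - r) / 4 + f (u - v) / 4 - f (v - r) / 8
  - f u / 2 + f v / 4 + f r / 4.

(** For large [|u|] the coefficients of [f u] add up to [1/4 - 1/8 - 1/2 + 1/4 = -1/8], and the
    shift errors to [2 f u / |u|]. From [|u| >= 80] on these errors are at most [f u / 40], which
    leaves [- f u / 10 <= - |u| / 10]. For smaller [|u|] all terms are bounded, crudely by means of
    [81 ^+ 2], and [7000] absorbs them. *)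
Lemma kernel_exponent_le u v r : `|v - u| <= 1 -> `|r| <= 1 ->
  kernel_exponent u v r <= 7000 - `|u| / 10.
Proof.
move=> vu r1; rewrite /kernel_exponent.
have fr : f r <= 1 by have := fbm_var_le_sqr (lexx 1) r1; rewrite expr1n.
have fuv : f (u - v) <= 1.
  by rewrite fbm_varBC; have := fbm_var_le_sqr (lexx 1) vu; rewrite expr1n.
have [u80|u80] := leP 80 `|u|.
  set x := `|u| in u80 *.
  have F0 := fbm_var_ge0 H u.
  have Fx : f u / x <= f u / 80.
    by rewrite ler_wpM2l// lef_pV2 ?posrE//; lra.
  have h1 : f (u - r) <= f u * (1 + 3 / x).
    by apply: fbm_var_shift_le; [rewrite -/x; lra|rewrite addrC addKr normrN].
  have h2 : f v <= f u * (1 + 3 / x) by apply: fbm_var_shift_le => //; rewrite -/x; lra.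
  have h3 : f u * (1 - 4 / x) <= f (v - r).
    apply: fbm_var_shift_ge; first by rewrite -/x; lra.
    rewrite addrAC; apply: le_trans (ler_normB _ _) _; lra.
  have h4 : x <= f u by apply: fbm_var_ge_norm; rewrite -/x; lra.
  have e1 : f u * (1 + 3 / x) = f u + 3 * (f u / x) by ring.
  have e2 : f u * (1 - 4 / x) = f u - 4 * (f u / x) by ring.
  rewrite e1 in h1 h2; rewrite e2 in h3.
  by lra.
have h1 : f (u - r) <= 81 ^+ 2.
  by apply: fbm_var_le_sqr; [lra|apply: le_trans (ler_normB _ _) _; lra].
have h2 : f v <= 81 ^+ 2.
  apply: fbm_var_le_sqr; first lra.
  by rewrite -(subrK u v); apply: le_trans (ler_normD _ _) _; lra.
have h3 := fbm_var_ge0 H (v - r); have h4 := fbm_var_ge0 H u.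
have e : (81 : R) ^+ 2 = 6561 by ring.
rewrite e in h1 h2; lra.
Qed.

Lemma kernel_exponent_bound : {C : R | forall u v r, `|v - u| <= 1 -> `|r| <= 1 ->
  kernel_exponent u v r <= C - `|u| / 10}.
Proof. by exists 7000; exact: kernel_exponent_le. Qed.

(** Drawn from the existence statement, so that the numerical value stays out of the later
    estimates. *)
Definition kernel_cst : R := sval kernel_exponent_bound.

End fbm_var_bounds.

Section kernel.
Context d (T : measurableType d) (R : realType) (P : probability T R).
Variables (H : R) (W : R -> T -> R).
Hypothesis hH : 1 / 2 <= H <= 1.
Hypothesis hW : is_fBM P H W.
Local Notation xi := (log_Zproc H W).

Lemma kernel_mean u v r :
  (\int[P]_w (expR (xi u w - xi v w / 2 - xi r w / 2))%:E =
   (expR (kernel_exponent H u v r))%:E)%E.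
Proof.
pose l : seq (R * R) := [:: (1, u); (- 2^-1, v); (- 2^-1, r)].
have E w : expR (xi u w - xi v w / 2 - xi r w / 2) =
   expR (- fbm_var H u / 2 + fbm_var H v / 4 + fbm_var H r / 4) * expR (lincomb W l w).
  rewrite -expRD; congr expR; rewrite /lincomb /l !big_cons big_nil /= /log_Zproc.
  by field.
under eq_integral do rewrite E EFinM.
rewrite ge0_integralZl_EFin//.
- rewrite (fbm_expR_lincomb hW) -EFinM -expRD; congr (expR _)%:E.
  rewrite /l !big_cons !big_nil /= /fbm_cov /kernel_exponent.
  rewrite !subrr fbm_var0 ?gt_eqF//; last by move: hH => /andP[h1 h2]; lra.
  rewrite (fbm_varBC _ v u) (fbm_varBC _ r u) (fbm_varBC _ r v).
  by field.
- apply/measurable_EFinP; apply: measurableT_comp => //; exact: (measurable_fbm_lincomb hW).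
Qed.

Lemma kernel_mean_le u v r : `|v - u| <= 1 -> `|r| <= 1 ->
  (\int[P]_w (expR (xi u w - xi v w / 2 - xi r w / 2))%:E <=
   (expR (kernel_cst hH - `|u| / 10))%:E)%E.
Proof.
move=> vu r1; rewrite kernel_mean lee_fin ler_expR /kernel_cst.
by case: kernel_exponent_bound => C /=; exact.
Qed.

End kernel.

Lemma integral_expR_norm_lty (R : realType) (c : R) : 0 < c ->
  (\int[leb]_u (expR (- c * `|u|))%:E < +oo)%E.
Proof.
move=> c0.
rewrite ge0_symfun_integralT//=; last 2 first.
- move=> u; apply: (@continuous_cvg _ _ _ _ _ (fun u : R => - c * `|u|)); first exact: continuous_expR.
  by apply: cvgMl_tmp; apply: cvg_norm; exact: cvg_id.
- by move=> u; rewrite /= normrN.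
rewrite lte_mul_pinfty//.
have -> : (\int[leb]_(x in [set x | (0 <= x)%R]) (expR (- c * `|x|))%:E)%E =
   ((c^-1)%:E * \int[leb]_x (exponential_pdf c x)%:E)%E.
  rewrite -ge0_integralZl_EFin//; last 3 first.
  - by move=> x _; rewrite lee_fin exponential_pdf_ge0// ltW.
  - by apply/measurable_EFinP; exact: measurable_exponential_pdf.
  - by rewrite invr_ge0 ltW.
  rewrite [LHS]integral_mkcond; apply: eq_integral => x _.
  rewrite /patch mem_setE/=; case: ifPn => x0.
    by rewrite exponential_pdfE//= -EFinM mulrA mulVf ?gt_eqF// mul1r ger0_norm.
  by rewrite lt0_exponential_pdf ?mule0// ltNge.
by rewrite integral_exponential_pdf// mule1 ltry.
Qed.

Section domination.
Context d (T : measurableType d) (R : realType) (P : probability T R).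
Variables (H : R) (W : R -> T -> R).
Hypothesis hH : 1 / 2 <= H <= 1.
Hypothesis hW : is_fBM P H W.
Local Notation xi := (log_Zproc H W).
Local Notation C0 := (kernel_cst hH).

Let H0 : 0 < H. Proof. by move: hH => /andP[h1 h2]; lra. Qed.

Lemma measurable_log_Zproc_joint : measurable_fun setT (fun p : T * R => xi p.2 p.1).
Proof.
apply: measurable_fun_continuous_process; first by move=> t; exact: (measurable_log_Zproc hW).
by move=> w; exact: (log_Zproc_continuous H0 hW).
Qed.

Lemma measurable_log_Zproc_comp d' (E : measurableType d') (a : E -> T) (b : E -> R) :
  measurable_fun setT a -> measurable_fun setT b ->
  measurable_fun setT (fun x => xi (b x) (a x)).
Proof.
move=> ma mb; apply: (measurableT_comp measurable_log_Zproc_joint (g := fun x => (a x, b x))).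
exact: measurable_fun_pair.
Qed.

(** The moving window around [u] is encoded as the indicator of a set of pairs, which gives the
    joint measurability required by Tonelli. *)
Definition near1 (u v : R) : R := \1_[set p : R * R | `|p.2 - p.1| <= 1] (u, v).

Lemma near1_ge0 u v : 0 <= near1 u v. Proof. by []. Qed.

Lemma near1E u v : near1 u v = (`|v - u| <= 1)%R%:R.
Proof.
rewrite /near1 indicE; congr (nat_of_bool _)%:R.
by apply/idP/idP => [/set_mem|h]; last exact/mem_set.
Qed.

Lemma measurable_near1 : measurable_fun setT (fun p : R * R => near1 p.1 p.2).
Proof.
rewrite (_ : (fun p => _) = \1_[set p : R * R | `|p.2 - p.1| <= 1]); last first.
  by apply/funext => -[u v].
apply: measurable_indic.
have m : measurable_fun setT (fun p : R * R => `|p.2 - p.1|).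
  by apply: measurableT_comp => //; apply: measurable_funB.
have := m measurableT `]-oo, 1]%classic (measurable_itv _).
rewrite setTI; congr (measurable _).
Qed.

(** The window has length [2], so that it contains both [[u - 1, u]] and [[u, u + 1]] and one
    quantity serves whichever of them is available. *)
Definition local_invsqrt (w : T) (u : R) : \bar R :=
  (\int[leb]_v (near1 u v * expR (- (xi v w / 2)))%:E)%E.

(* [1/12 = (1/6)/2]: the tilts [e^{mu}] with [|m| <= 1/6] are absorbed. *)
Definition dom_weight (w : T) (u : R) : \bar R :=
  ((expR (xi u w + `|u| / 12))%:E * local_invsqrt w u)%E.

Definition dom_mass (w : T) : \bar R := (\int[leb]_u dom_weight w u)%E.

Definition invsqrt01 (w : T) : \bar R := (\int[leb]_(r in `[0%R, 1%R]) (expR (- (xi r w / 2)))%:E)%E.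

Lemma local_invsqrt_ge0 w u : (0 <= local_invsqrt w u)%E.
Proof. by apply: integral_ge0 => v _; rewrite lee_fin mulr_ge0 ?near1_ge0 ?expR_ge0. Qed.

Lemma dom_weight_ge0 w u : (0 <= dom_weight w u)%E.
Proof. by rewrite mule_ge0 ?lee_fin ?expR_ge0 ?local_invsqrt_ge0. Qed.

Lemma dom_mass_ge0 w : (0 <= dom_mass w)%E.
Proof. by apply: integral_ge0 => u _; exact: dom_weight_ge0. Qed.

Lemma invsqrt01_ge0 w : (0 <= invsqrt01 w)%E.
Proof. by apply: integral_ge0 => r _; rewrite lee_fin expR_ge0. Qed.

Lemma measurable_expR_log_Zproc : measurable_fun setT (fun p : T * R => expR (- (xi p.2 p.1 / 2))).
Proof.
apply: measurableT_comp => //; apply: measurableT_comp => //.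
by apply: measurable_funM => //; exact: measurable_log_Zproc_joint.
Qed.

Lemma measurable_local_invsqrt : measurable_fun setT (fun p : T * R => local_invsqrt p.1 p.2).
Proof.
apply: (@measurable_fun_fubini_tonelli_F _ _ (T * R)%type _ R leb
  (fun q : (T * R) * R => (near1 q.1.2 q.2 * expR (- (xi q.2 q.1.1 / 2)))%:E)).
- apply/measurable_EFinP; apply: measurable_funM.
    apply: (measurableT_comp measurable_near1 (g := fun q : (T * R) * R => (q.1.2, q.2))).
    by apply: measurable_fun_pair => //; exact: measurableT_comp.
  apply: (measurableT_comp measurable_expR_log_Zproc (g := fun q : (T * R) * R => (q.1.1, q.2))).
  by apply: measurable_fun_pair => //; exact: measurableT_comp.
- by move=> q; rewrite lee_fin mulr_ge0 ?near1_ge0 ?expR_ge0.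
Qed.

Lemma measurable_dom_weight : measurable_fun setT (fun p : T * R => dom_weight p.1 p.2).
Proof.
apply: emeasurable_funM; last exact: measurable_local_invsqrt.
apply/measurable_EFinP; apply: measurableT_comp => //; apply: measurable_funD.
  exact: measurable_log_Zproc_joint.
by apply: measurable_funM => //; apply: measurableT_comp.
Qed.

Lemma measurable_dom_mass : measurable_fun setT dom_mass.
Proof.
apply: (@measurable_fun_fubini_tonelli_F _ _ T _ R leb (fun p : T * R => dom_weight p.1 p.2)).
  exact: measurable_dom_weight.
by move=> p; exact: dom_weight_ge0.
Qed.

Lemma invsqrt01_indic w :
  invsqrt01 w = (\int[leb]_r (\1_`[0%R, 1%R] r * expR (- (xi r w / 2)))%:E)%E.
Proof.
rewrite /invsqrt01 integral_mkcond; apply: eq_integral => r _.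
by rewrite epatch_indic -EFinM mulrC.
Qed.

Lemma measurable_invsqrt01 : measurable_fun setT invsqrt01.
Proof.
rewrite (_ : invsqrt01 = fun w => (\int[leb]_r (\1_`[0%R, 1%R] r * expR (- (xi r w / 2)))%:E)%E).
  apply: (@measurable_fun_fubini_tonelli_F _ _ T _ R leb
    (fun p : T * R => (\1_`[0%R, 1%R] p.2 * expR (- (xi p.2 p.1 / 2)))%:E)).
    apply/measurable_EFinP; apply: measurable_funM; last exact: measurable_expR_log_Zproc.
    by apply: measurableT_comp => //; exact: measurable_indic.
  by move=> p; rewrite lee_fin mulr_ge0 ?expR_ge0.
by apply/funext => w; exact: invsqrt01_indic.
Qed.

(** [2] is the length of the window; [1/60 = 1/10 - 1/12] is the decay of the kernel mean minus the
    growth allowed in [dom_weight]. *)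
Definition dom_const : \bar R := (\int[leb]_u (2 * expR (C0 - `|u| / 60))%:E)%E.

Lemma dom_const_lty : (dom_const < +oo)%E.
Proof.
rewrite /dom_const (_ : (fun u => _) = (fun u : R => (2 * expR C0)%:E * (expR (- 60^-1 * `|u|))%:E)%E).
  rewrite ge0_integralZl_EFin//.
  - apply: lte_mul_pinfty => //; apply: integral_expR_norm_lty.
    by rewrite invr_gt0.
  - apply/measurable_EFinP; apply: measurableT_comp => //.
    by apply: measurable_funM => //; exact: measurableT_comp.
apply/funext => u; rewrite -EFinM -mulrA -expRD; congr (_ * expR _)%:E.
by rewrite mulNr mulrC.
Qed.

Lemma local_kernel_mean_le r u : `|r| <= 1 ->
  (\int[P]_w ((expR (xi u w - xi r w / 2))%:E * local_invsqrt w u) <=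
   (2 * expR (C0 - `|u| / 10))%:E)%E.
Proof.
move=> r1.
have m1 w : measurable_fun setT (fun v => near1 u v * expR (- (xi v w / 2))).
  apply: measurable_funM.
    by apply: (measurableT_comp measurable_near1 (g := fun v : R => (u, v))); exact: measurable_fun_pair.
  by apply: (measurableT_comp measurable_expR_log_Zproc (g := fun v : R => (w, v))); exact: measurable_fun_pair.
pose F (p : T * R) := (near1 u p.2 * expR (xi u p.1 - xi p.2 p.1 / 2 - xi r p.1 / 2))%:E.
have F0 p : (0 <= F p)%E by rewrite lee_fin mulr_ge0 ?near1_ge0 ?expR_ge0.
have mker v : measurable_fun setT (fun w => expR (xi u w - xi v w / 2 - xi r w / 2)).
  apply: measurableT_comp => //; apply: measurable_funB; last first.
    by apply: measurable_funM => //; exact: (measurable_log_Zproc hW).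
  apply: measurable_funB; first exact: (measurable_log_Zproc hW).
  by apply: measurable_funM => //; exact: (measurable_log_Zproc hW).
have mF : measurable_fun setT F.
  apply/measurable_EFinP; apply: measurable_funM.
    apply: (measurableT_comp measurable_near1 (g := fun p : T * R => (u, p.2))).
    exact: measurable_fun_pair.
  apply: measurableT_comp => //; apply: measurable_funB; last first.
    by apply: measurable_funM => //; exact: measurable_log_Zproc_comp.
  apply: measurable_funB; first exact: measurable_log_Zproc_comp.
  by apply: measurable_funM => //; exact: measurable_log_Zproc_comp.
have -> : (\int[P]_w ((expR (xi u w - xi r w / 2))%:E * local_invsqrt w u) =
   \int[P]_w \int[leb]_v F (w, v))%E.
  apply: eq_integral => w _; rewrite -ge0_integralZl_EFin//; last 2 first.
  - by move=> v _; rewrite lee_fin mulr_ge0 ?near1_ge0 ?expR_ge0.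
  - by apply/measurable_EFinP; exact: m1.
  apply: eq_integral => v _; rewrite -EFinM mulrCA -expRD; congr (_ * expR _)%:E.
  by ring.
rewrite fubini_tonelli//.
apply: (@le_trans _ _ (\int[leb]_v (near1 u v * expR (C0 - `|u| / 10))%:E)%E).
  apply: ge0_le_integral => //.
  - by move=> v _; apply: integral_ge0 => w _; exact: F0.
  - exact: (@measurable_fun_fubini_tonelli_G _ _ T _ R P F).
  - apply/measurable_EFinP; apply: measurable_funM => //.
    by apply: (measurableT_comp measurable_near1 (g := fun v : R => (u, v))); exact: measurable_fun_pair.
  - move=> v _; under eq_integral do rewrite /F /= EFinM.
    rewrite ge0_integralZl_EFin//; last first.
    + by apply/measurable_EFinP; exact: mker.
    rewrite EFinM near1E; have [vu|_] := boolP (`|v - u| <= 1); last by rewrite !mul0e.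
    by rewrite !mul1e; exact: kernel_mean_le.
have -> : (\int[leb]_v (near1 u v * expR (C0 - `|u| / 10))%:E =
  \int[leb]_(v in `[(u - 1)%R, (u + 1)%R]) cst (expR (C0 - `|u| / 10))%:E v)%E.
  rewrite [RHS]integral_mkcond; apply: eq_integral => v _.
  rewrite epatch_indic near1E -EFinM mulrC indicE; congr (_ * _%:R)%:E; congr nat_of_bool.
  by rewrite mem_setE in_itv/= ler_distl.
rewrite integral_cst//= lebesgue_measure_itv/= lte_fin ltrD2l gtrN// -EFinD -EFinM lee_fin.
by rewrite mulrC ler_wpM2r ?expR_ge0//; lra.
Qed.

Lemma expR_dom_mass_mean_le r : `|r| <= 1 ->
  (\int[P]_w ((expR (- (xi r w / 2)))%:E * dom_mass w) <= dom_const)%E.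
Proof.
move=> r1.
pose F (p : T * R) := ((expR (- (xi r p.1 / 2)))%:E * dom_weight p.1 p.2)%E.
have F0 p : (0 <= F p)%E by rewrite mule_ge0 ?dom_weight_ge0// lee_fin expR_ge0.
have mr : measurable_fun setT (fun w => expR (- (xi r w / 2))).
  apply: measurableT_comp => //; apply: measurableT_comp => //.
  by apply: measurable_funM => //; exact: (measurable_log_Zproc hW).
have mF : measurable_fun setT F.
  apply: emeasurable_funM; last exact: measurable_dom_weight.
  by apply/measurable_EFinP; exact: (measurableT_comp mr measurable_fst).
have mdw w : measurable_fun setT (dom_weight w).
  by apply: (measurableT_comp measurable_dom_weight (g := fun u : R => (w, u))); exact: measurable_fun_pair.
have -> : (\int[P]_w ((expR (- (xi r w / 2)))%:E * dom_mass w) =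
    \int[P]_w \int[leb]_u F (w, u))%E.
  apply: eq_integral => w _; rewrite -ge0_integralZl_EFin//; last exact: mdw.
  by move=> u _; exact: dom_weight_ge0.
rewrite fubini_tonelli//; apply: ge0_le_integral => //.
- by move=> u _; apply: integral_ge0 => w _; exact: F0.
- exact: (@measurable_fun_fubini_tonelli_G _ _ T _ R P F).
- apply/measurable_EFinP; apply: measurable_funM => //; apply: measurableT_comp => //.
  apply: measurable_funB => //; apply: measurable_funM => //; exact: measurableT_comp.
- move=> u _.
  have -> : (\int[P]_w F (w, u) = (expR (`|u| / 12))%:E *
      \int[P]_w ((expR (xi u w - xi r w / 2))%:E * local_invsqrt w u))%E.
    rewrite -ge0_integralZl_EFin//; last 2 first.
    + by move=> w _; rewrite mule_ge0 ?lee_fin ?expR_ge0 ?local_invsqrt_ge0.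
    + apply: emeasurable_funM.
        apply/measurable_EFinP; apply: measurableT_comp => //; apply: measurable_funB.
          exact: (measurable_log_Zproc hW).
        by apply: measurable_funM => //; exact: (measurable_log_Zproc hW).
      apply: (measurableT_comp measurable_local_invsqrt (g := fun w : T => (w, u))).
      exact: measurable_fun_pair.
    apply: eq_integral => w _; rewrite /F /dom_weight /= !muleA -!EFinM; congr (_%:E * _)%E.
    by rewrite -!expRD; congr expR; ring.
  apply: (@le_trans _ _ ((expR (`|u| / 12))%:E * (2 * expR (C0 - `|u| / 10))%:E)%E).
    by apply: lee_wpmul2l; [rewrite lee_fin expR_ge0|exact: local_kernel_mean_le].
  rewrite -EFinM lee_fin mulrCA -expRD ler_wpM2l// ler_expR.
  by have := normr_ge0 u; lra.
Qed.

Lemma log_Zproc0 w : xi 0 w = 0.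
Proof. by rewrite /log_Zproc (fbm0 hW) fbm_var0 ?gt_eqF// mul0r subr0. Qed.

Lemma dom_mass_mean_le : (\int[P]_w dom_mass w <= dom_const)%E.
Proof.
apply: le_trans (@expR_dom_mass_mean_le 0 _); last by rewrite normr0 ler01.
rewrite le_eqVlt; apply/orP; left; apply/eqP; apply: eq_integral => w _.
by rewrite log_Zproc0 mul0r oppr0 expR0 mul1e.
Qed.

Lemma dom_mass_invsqrt01_mean_le : (\int[P]_w (invsqrt01 w * dom_mass w) <= dom_const)%E.
Proof.
pose F (p : T * R) := ((\1_`[0%R, 1%R] p.2 * expR (- (xi p.2 p.1 / 2)))%:E * dom_mass p.1)%E.
have g0 w r : 0 <= \1_`[0%R, 1%R] r * expR (- (xi r w / 2)) :> R by rewrite mulr_ge0 ?expR_ge0.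
have F0 p : (0 <= F p)%E by rewrite mule_ge0 ?dom_mass_ge0// lee_fin.
have mF : measurable_fun setT F.
  apply: emeasurable_funM; last exact: (measurableT_comp measurable_dom_mass).
  apply/measurable_EFinP; apply: measurable_funM; last exact: measurable_expR_log_Zproc.
  by apply: measurableT_comp => //; exact: measurable_indic.
have -> : (\int[P]_w (invsqrt01 w * dom_mass w) = \int[P]_w \int[leb]_r F (w, r))%E.
  apply: eq_integral => w _; rewrite invsqrt01_indic -ge0_integralZr//.
  - apply/measurable_EFinP; apply: measurable_funM; first exact: measurable_indic.
    by apply: (measurableT_comp measurable_expR_log_Zproc (g := fun v : R => (w, v))); exact: measurable_fun_pair.
  - exact: dom_mass_ge0.
rewrite fubini_tonelli//.
apply: (@le_trans _ _ (\int[leb]_(r in `[0%R, 1%R]) cst dom_const r)%E); last first.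
  by rewrite integral_cst//= lebesgue_measure_itv/= lte01 oppr0 adde0 mule1.
rewrite [leRHS]integral_mkcond; apply: ge0_le_integral => //.
- by move=> r _; apply: integral_ge0 => w _; exact: F0.
- exact: (@measurable_fun_fubini_tonelli_G _ _ T _ R P F).
- by apply/(measurable_restrictT _ _).1.
move=> r _; rewrite /patch; case: ifPn => [|r01].
  rewrite inE/= in_itv/= => /andP[r0 r1].
  apply: le_trans (@expR_dom_mass_mean_le r _); last by rewrite ger0_norm.
  rewrite le_eqVlt; apply/orP; left; apply/eqP; apply: eq_integral => w _.
  by rewrite /F/= indicE mem_set ?mul1r//= in_itv/= r0.
by rewrite integral0_eq// => w _; rewrite /F/= indicE (negbTE r01) mul0r mul0e.
Qed.

Lemma invsqrt01_mean_le : (\int[P]_w invsqrt01 w <= (expR C0)%:E)%E.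
Proof.
pose F (p : T * R) := (\1_`[0%R, 1%R] p.2 * expR (- (xi p.2 p.1 / 2)))%:E.
have F0 p : (0 <= F p)%E by rewrite lee_fin mulr_ge0 ?expR_ge0.
have mF : measurable_fun setT F.
  apply/measurable_EFinP; apply: measurable_funM; last exact: measurable_expR_log_Zproc.
  by apply: measurableT_comp => //; exact: measurable_indic.
have -> : (\int[P]_w invsqrt01 w = \int[P]_w \int[leb]_r F (w, r))%E.
  by apply: eq_integral => w _; rewrite invsqrt01_indic.
rewrite fubini_tonelli//.
apply: (@le_trans _ _ (\int[leb]_(r in `[0%R, 1%R]) cst (expR C0)%:E r)%E); last first.
  by rewrite integral_cst//= lebesgue_measure_itv/= lte01 oppr0 adde0 mule1.
rewrite [leRHS]integral_mkcond; apply: ge0_le_integral => //.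
- by move=> r _; apply: integral_ge0 => w _; exact: F0.
- exact: (@measurable_fun_fubini_tonelli_G _ _ T _ R P F).
- by apply/(measurable_restrictT _ _).1.
move=> r _; rewrite /patch; case: ifPn => [|r01].
  rewrite inE/= in_itv/= => /andP[r0 r1].
  (* At [u = v = 0] the kernel reduces to [Z_r^{-1/2}], because [Z_0 = 1]. *)
  have := @kernel_mean_le _ _ _ P _ _ hH hW 0 0 r.
  rewrite subrr normr0 mul0r subr0 ger0_norm// => /(_ ler01 r1); apply: le_trans.
  rewrite le_eqVlt; apply/orP; left; apply/eqP; apply: eq_integral => w _.
  by rewrite /F/= indicE mem_set ?mul1r//= ?in_itv/= ?r0// log_Zproc0 mul0r subr0 add0r.
by rewrite integral0_eq// => w _; rewrite /F/= indicE (negbTE r01) mul0r.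
Qed.

End domination.

(** * Jensen bounds and finiteness of the tilted masses *)

Section jensen.
Context (R : realType).

(* The tangent of [x |-> x^{-1/2}] at [s^2], evaluated at [e^{-2}]. *)
Lemma invsqrt_tangent (e s : R) : 0 < e -> 0 < s ->
  3 / (2 * s) <= e + (2 * s ^+ 3)^-1 * e ^- 2.
Proof.
move=> e0 s0; set y := (e * s)^-1.
have y0 : 0 < y by rewrite invr_gt0 mulr_gt0.
have ->: e = (y * s)^-1 by rewrite /y; field; rewrite !gt_eqF.
have h : 0 <= (y - 1) ^+ 2 * (y + 2) by rewrite mulr_ge0 ?sqr_ge0//; lra.
rewrite -subr_ge0.
have -> : (y * s)^-1 + (2 * s ^+ 3)^-1 * (y * s)^-1 ^- 2 - 3 / (2 * s) =
   ((y - 1) ^+ 2 * (y + 2)) / (2 * y * s).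
  by field; rewrite !gt_eqF.
by rewrite divr_ge0// !mulr_ge0// ltW.
Qed.

(** Integrate the tangent of [x |-> x^{-1/2}] at [D] over the unit interval. Its slope is negative,
    so an upper bound [D] on the mass is enough, and the right-hand side may be infinite. *)
Lemma invsqrt_jensen (phi : R -> R) (c D : R) : measurable_fun setT phi -> 0 < D ->
  (\int[leb]_(v in `[c, (c + 1)%R]) (expR (phi v))%:E <= D%:E)%E ->
  ((Num.sqrt D)^-1%:E <= \int[leb]_(v in `[c, (c + 1)%R]) (expR (- (phi v / 2)))%:E)%E.
Proof.
move=> mphi D0 hD; set s := Num.sqrt D.
have s0 : 0 < s by rewrite sqrtr_gt0.
have Ds : D = s ^+ 2 by rewrite sqr_sqrtr// ltW.
pose k := (2 * s ^+ 3)^-1.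
have k0 : 0 <= k by rewrite invr_ge0 mulr_ge0// exprn_ge0// ltW.
set I := [set` `[c, c + 1]].
have mI : measurable I by exact: measurable_itv.
have m1 : measurable_fun I (fun v => (expR (phi v))%:E).
  by apply/measurable_EFinP/measurable_funTS; apply: measurableT_comp.
have m2 : measurable_fun I (fun v => (expR (- (phi v / 2)))%:E).
  apply/measurable_EFinP/measurable_funTS; apply: measurableT_comp => //.
  by apply: measurableT_comp => //; apply: measurable_funM.
have h : ((3 / (2 * s))%:E <= \int[leb]_(v in I) (expR (- (phi v / 2)))%:E +
   k%:E * \int[leb]_(v in I) (expR (phi v))%:E)%E.
  rewrite -ge0_integralZl_EFin// -ge0_integralD//; last 2 first.
  - by move=> v _; rewrite -EFinM lee_fin mulr_ge0 ?expR_ge0.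
  - exact: measurable_funeM.
  have -> : ((3 / (2 * s))%:E = \int[leb]_(v in I) cst (3 / (2 * s))%:E v)%E.
    rewrite integral_cst//= lebesgue_measure_itv/= lte_fin ltrDl ltr01.
    by rewrite -EFinD (addrC c) addrK mule1.
  apply: ge0_le_integral => //.
  - by move=> v _; rewrite lee_fin divr_ge0// mulr_ge0// ltW.
  - apply: emeasurable_funD => //; exact: measurable_funeM.
  move=> v _; rewrite -EFinM -EFinD lee_fin.
  apply: le_trans (invsqrt_tangent (expR_gt0 (- (phi v / 2))) s0) _.
  rewrite lerD2l -/k ler_wpM2l// -expRM_natl -expRN le_eqVlt; apply/orP; left; apply/eqP.
  by congr expR; field.
have h2 : (k%:E * \int[leb]_(v in I) (expR (phi v))%:E <= (2 * s)^-1%:E)%E.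
  apply: (@le_trans _ _ (k%:E * D%:E)%E); first by apply: lee_wpmul2l => //; rewrite lee_fin.
  rewrite -EFinM lee_fin Ds /k le_eqVlt; apply/orP; left; apply/eqP.
  by field; rewrite gt_eqF.
have {}h : ((3 / (2 * s))%:E <= \int[leb]_(v in I) (expR (- (phi v / 2)))%:E + (2 * s)^-1%:E)%E.
  by apply: (le_trans h); rewrite leeD2l.
rewrite -leeBlDr// -EFinD in h; apply: le_trans h; rewrite lee_fin le_eqVlt; apply/orP; left; apply/eqP.
by field; rewrite gt_eqF.
Qed.

End jensen.

Section pathwise.
Context d (T : measurableType d) (R : realType) (P : probability T R).
Variables (H : R) (W : R -> T -> R).
Hypothesis hH : 1 / 2 <= H <= 1.
Hypothesis hW : is_fBM P H W.
Local Notation xi := (log_Zproc H W).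
Local Notation S0 := (dom_mass H W).
Local Notation A0 := (local_invsqrt H W).

Let H0 : 0 < H. Proof. by move: hH => /andP[h1 h2]; lra. Qed.

Definition tilted (m : R) (w : T) (u : R) : R := expR (xi u w + m * u).

Lemma tilted_gt0 m w u : 0 < tilted m w u. Proof. exact: expR_gt0. Qed.

Lemma ZmassE m w : Zmass H W m w = (\int[leb]_u (tilted m w u)%:E)%E.
Proof. by apply: eq_integral => u _; rewrite /tilted expRD. Qed.

Lemma tilted_exponent_continuous m w : continuous (fun u => xi u w + m * u).
Proof.
move=> u; apply: cvgD; first exact: (log_Zproc_continuous H0 hW).
by apply: cvgMl_tmp; exact: cvg_id.
Qed.

Lemma tilted_continuous m w : continuous (tilted m w).
Proof.
move=> u; apply: (@continuous_cvg _ _ _ _ _ (fun u => xi u w + m * u)).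
  exact: continuous_expR.
exact: tilted_exponent_continuous.
Qed.

Lemma measurable_tilted_exponent m w : measurable_fun setT (fun u => xi u w + m * u).
Proof. by apply: continuous_measurable_fun; exact: tilted_exponent_continuous. Qed.

Lemma measurable_tilted m w : measurable_fun setT (tilted m w).
Proof. by apply: continuous_measurable_fun; exact: tilted_continuous. Qed.

Lemma measurable_tilted_joint m : measurable_fun setT (fun p : T * R => tilted m p.1 p.2).
Proof.
apply: measurableT_comp => //; apply: measurable_funD; first exact: (measurable_log_Zproc_joint hH hW).
exact: measurable_funM.
Qed.

(** On the window the exponent [m * v] differs from [m * u] by at most [1/6]; the square root halves
    this to [1/12]. *)
Lemma invsqrt_le_local m w u c D : `|m| <= 6^-1 -> 0 < D ->
  u - 1 <= c <= u ->
  (\int[leb]_(v in `[c, (c + 1)%R]) (tilted m w v)%:E <= D%:E)%E ->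
  ((Num.sqrt D)^-1%:E <= (expR (12^-1 - m * u / 2))%:E * A0 w u)%E.
Proof.
move=> m6 D0 /andP[c1 c2] hD.
apply: le_trans (invsqrt_jensen (measurable_tilted_exponent m w) D0 hD) _.
have m1 : measurable_fun setT (fun v => near1 u v * expR (- (xi v w / 2))).
  apply: measurable_funM.
    by apply: (measurableT_comp (@measurable_near1 R) (g := fun v : R => (u, v))); exact: measurable_fun_pair.
  by apply: (measurableT_comp (measurable_expR_log_Zproc hH hW) (g := fun v : R => (w, v))); exact: measurable_fun_pair.
have g0 v : 0 <= near1 u v * expR (- (xi v w / 2)) by rewrite mulr_ge0 ?near1_ge0 ?expR_ge0.
rewrite -ge0_integralZl_EFin//; last 2 first.
- by move=> v _; rewrite lee_fin.
- exact/measurable_EFinP.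
apply: (@le_trans _ _ (\int[leb]_(v in `[c, (c + 1)%R])
   ((expR (12^-1 - m * u / 2))%:E * (near1 u v * expR (- (xi v w / 2)))%:E))%E); last first.
  apply: ge0_subset_integral => //.
  - by apply: measurable_funeM; exact/measurable_EFinP.
  - by move=> v _; rewrite -EFinM lee_fin mulr_ge0// expR_ge0.
apply: ge0_le_integral => //.
- apply/measurable_EFinP/measurable_funTS; apply: measurableT_comp => //.
  apply: measurableT_comp => //; apply: measurable_funM => //; exact: measurable_tilted_exponent.
- by apply: measurable_funTS; apply: measurable_funeM; exact/measurable_EFinP.
move=> v; rewrite /= in_itv/= => /andP[cv vc].
have vu : `|v - u| <= 1 by rewrite ler_norml; apply/andP; split; lra.
rewrite -EFinM lee_fin near1E vu mul1r -expRD ler_expR.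
have : m * (u - v) <= 6^-1.
  apply: le_trans (ler_norm _) _; rewrite normrM distrC -[leRHS]mulr1.
  exact: ler_pM.
by lra.
Qed.

Lemma local_weight_le m w u : `|m| <= 6^-1 ->
  ((tilted m w u)%:E * ((expR (12^-1 - m * u / 2))%:E * A0 w u) <=
   (expR 12^-1)%:E * dom_weight H W w u)%E.
Proof.
move=> m6; rewrite /dom_weight !muleA -!EFinM; apply: lee_wpmul2r.
  exact: local_invsqrt_ge0.
rewrite lee_fin -!expRD ler_expR.
have : m * u <= 6^-1 * `|u|.
  by apply: le_trans (ler_norm _) _; rewrite normrM ler_wpM2r.
by lra.
Qed.

(** A self-bounding argument. Let [D] be the mass of [[-N, N]], finite by compactness. Each [u] in
    it has a unit interval on its inner side that stays inside, so the Jensen bound controls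
    [D^{-1/2}] by [local_invsqrt] at [u]. Integrating this against the tilted weight turns the left
    side into [D / sqrt D = sqrt D] and the right side into a multiple of [S0 w], uniformly in
    [N]. *)
Lemma Zmass_trunc_le m w n : `|m| <= 6^-1 -> (S0 w < +oo)%E ->
  (\int[leb]_(v in `[(- n.+1%:R)%R, n.+1%:R]) (tilted m w v)%:E <=
   ((expR 12^-1 * fine (S0 w)) ^+ 2)%:E)%E.
Proof.
move=> m6 S0oo; set N : R := n.+1%:R.
have N1 : 1 <= N by rewrite /N ler1n.
have iN : leb.-integrable `[- N, N] (fun v => (tilted m w v)%:E).
  apply: continuous_compact_integrable; first exact: segment_compact.
  by apply: continuous_subspaceT; exact: tilted_continuous.
have fN : (\int[leb]_(v in `[(- N)%R, N]) (tilted m w v)%:E)%E \is a fin_num.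
  exact: integrable_fin_num.
set D := fine (\int[leb]_(v in `[(- N)%R, N]) (tilted m w v)%:E)%E.
have DE : (\int[leb]_(v in `[(- N)%R, N]) (tilted m w v)%:E = D%:E)%E by rewrite fineK.
rewrite DE lee_fin.
have [D0|D0] := leP D 0; first by rewrite (le_trans D0)// sqr_ge0.
have mtN : measurable_fun `[- N, N] (fun v => (tilted m w v)%:E).
  by apply/measurable_EFinP/measurable_funTS; exact: measurable_tilted.
have sub c : - N <= c -> c + 1 <= N ->
   (\int[leb]_(v in `[c, (c + 1)%R]) (tilted m w v)%:E <= D%:E)%E.
  move=> c1 c2; rewrite -DE; apply: ge0_subset_integral => //.
  - by move=> v _; rewrite lee_fin ltW// tilted_gt0.
  - by apply: subset_itv; rewrite bnd_simp.
have loc u : u \in `[- N, N] -> ((Num.sqrt D)^-1%:E <= (expR (12^-1 - m * u / 2))%:E * A0 w u)%E.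
  rewrite in_itv/= => /andP[u1 u2]; have [u0|u0] := leP u 0.
    apply: (@invsqrt_le_local m w u u) => //; first by apply/andP; split; lra.
    by apply: sub; lra.
  apply: (@invsqrt_le_local m w u (u - 1)) => //; first by apply/andP; split; lra.
  by apply: sub; lra.
have sD : 0 < Num.sqrt D by rewrite sqrtr_gt0.
have key : ((Num.sqrt D)%:E <= (expR 12^-1)%:E * S0 w)%E.
  have -> : ((Num.sqrt D)%:E = \int[leb]_(v in `[(- N)%R, N]) ((Num.sqrt D)^-1%:E * (tilted m w v)%:E))%E.
    rewrite ge0_integralZl_EFin//; last by move=> v _; rewrite lee_fin ltW// tilted_gt0.
    have hD : D = Num.sqrt D ^+ 2 by rewrite sqr_sqrtr// ltW.
    rewrite DE -EFinM [X in _ * X]hD; congr EFin.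
    by move: (Num.sqrt D) sD => s s0; field; rewrite gt_eqF.
  have mdw : measurable_fun setT (dom_weight H W w).
    by apply: (measurableT_comp (measurable_dom_weight hH hW) (g := fun u : R => (w, u))); exact: measurable_fun_pair.
  rewrite -ge0_integralZl_EFin//; last by move=> u _; exact: dom_weight_ge0.
  apply: (@le_trans _ _ (\int[leb]_(v in `[(- N)%R, N]) ((expR 12^-1)%:E * dom_weight H W w v))%E); last first.
    apply: ge0_subset_integral => //; first exact: measurable_funeM.
    by move=> u _; rewrite mule_ge0 ?lee_fin ?expR_ge0 ?dom_weight_ge0.
  apply: ge0_le_integral => //.
  - by move=> u _; rewrite -EFinM lee_fin mulr_ge0 ?invr_ge0 ?ltW ?tilted_gt0.
  - exact: measurable_funeM.
  - by apply: measurable_funTS; exact: measurable_funeM.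
  move=> u uN; apply: le_trans (local_weight_le _ _ m6).
  by rewrite muleC; apply: lee_wpmul2l; [rewrite lee_fin ltW// tilted_gt0|exact: loc].
have S0f : S0 w \is a fin_num by rewrite ge0_fin_numE// dom_mass_ge0.
rewrite -(fineK S0f) -EFinM lee_fin in key.
rewrite -(sqr_sqrtr (ltW D0)) ler_pXn2r ?nnegrE ?sqrtr_ge0//.
by apply: mulr_ge0; rewrite ?expR_ge0// fine_ge0// dom_mass_ge0.
Qed.

Lemma Zmass_le m w : `|m| <= 6^-1 -> (S0 w < +oo)%E ->
  (Zmass H W m w <= ((expR 12^-1 * fine (S0 w)) ^+ 2)%:E)%E.
Proof.
move=> m6 S0oo; rewrite ZmassE.
have UT : \bigcup_n [set` `[- n.+1%:R : R, n.+1%:R]] = setT.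
  apply/seteqP; split => // u _; exists (Num.truncn `|u|) => //=.
  by rewrite in_itv/= -ler_norml; apply: ltW; exact: truncnS_gt.
have c : (\int[leb]_(v in `[(- n.+1%:R)%R, n.+1%:R]) (tilted m w v)%:E @[n --> \oo] -->
   \int[leb]_(v in \bigcup_n [set` `[(- n.+1%:R : R)%R, n.+1%:R]]) (tilted m w v)%:E)%E.
  apply: (@ge0_nondecreasing_set_cvg_integral _ (measurableTypeR R) R (fun n => [set` `[- n.+1%:R : R, n.+1%:R]])
     (fun v => (tilted m w v)%:E) leb) => //.
  - move=> i j ij; rewrite subsetEset; apply: subset_itv; rewrite bnd_simp ?lerN2 ler_nat//.
  - by move=> i; apply/measurable_EFinP/measurable_funTS; exact: measurable_tilted.
  - by move=> i x _; rewrite lee_fin ltW// tilted_gt0.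
rewrite -UT -(cvg_lim _ c)//; apply: lime_le; first exact: cvgP c.
by apply: nearW => n; exact: Zmass_trunc_le.
Qed.

End pathwise.

(** * Moments of the tilted densities *)

Lemma normr_exp_le_expR (R : realType) (c : R) (k : nat) (u : R) : 0 < c ->
  `|u| ^+ k <= c ^+ k * k`!%:R * expR (`|u| / c).
Proof.
move=> c0; have x0 : 0 <= `|u| / c by rewrite divr_ge0// ltW.
have h : (`|u| / c) ^+ k <= k`!%:R * expR (`|u| / c).
  case: k => [|k]; first by rewrite expr0 fact0 mul1r -expR0 ler_expR.
  rewrite -ler_pdivrMl ?ltr0n ?fact_gt0// mulrC.
  by apply: le_trans (expR_ge1Dxn k x0); rewrite lerDr.
rewrite exprMn exprVn ler_pdivrMr ?exprn_gt0// in h.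
by rewrite -mulrA (mulrC (c ^+ k)).
Qed.

Section moments.
Context d (T : measurableType d) (R : realType) (P : probability T R).
Variables (H : R) (W : R -> T -> R).
Hypothesis hH : 1 / 2 <= H <= 1.
Hypothesis hW : is_fBM P H W.
Local Notation xi := (log_Zproc H W).
Local Notation S0 := (dom_mass H W).
Local Notation A0 := (local_invsqrt H W).
Local Notation J := (invsqrt01 H W).
Local Notation ZT := (tilted H W).
Local Notation mu := (@lebesgue_measure R).

Definition moment (k : nat) (m : R) (w : T) : R := \int[mu]_u (u ^+ k * ZT m w u).

Lemma moment0 m w : moment 0 m w = fine (Zmass H W m w).
Proof.
rewrite ZmassE /moment /Rintegral; congr fine; apply: eq_integral => u _.
by rewrite expr0 mul1r.
Qed.

Section good_path.
Variable w : T.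
Hypothesis S0w : (S0 w < +oo)%E.

Lemma tilted_integrable m : `|m| <= 6^-1 -> mu.-integrable setT (fun u => (ZT m w u)%:E).
Proof.
move=> m6; apply/integrableP; split.
  by apply/measurable_EFinP; exact: (measurable_tilted hH hW).
under eq_integral do rewrite gee0_abs ?lee_fin ?(ltW (tilted_gt0 _ _ _ _ _))//.
by rewrite -ZmassE; apply: le_lt_trans (Zmass_le hH hW m6 S0w) _; rewrite ltry.
Qed.

(** [1/56 = 1/7 - 1/8]: the power of [u] is absorbed in the gap between the tilts [|m| <= 1/8] and
    the tilts [1/7] and [-1/7], whose masses are finite since [1/7 <= 1/6]. *)
Definition moment_dom (k : nat) (u : R) : R :=
  56 ^+ k * k`!%:R * (ZT 7^-1 w u + ZT (- 7^-1) w u).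

Lemma moment_dom_ge0 k u : 0 <= moment_dom k u.
Proof. by rewrite !mulr_ge0// addr_ge0// ltW// tilted_gt0. Qed.

Lemma moment_dom_integrable k : mu.-integrable setT (fun u => (moment_dom k u)%:E).
Proof.
under eq_fun do rewrite EFinM EFinD; apply: integrableZl => //; apply: integrableD => //.
  by apply: tilted_integrable; rewrite ger0_norm; lra.
by apply: tilted_integrable; rewrite normrN ger0_norm; lra.
Qed.

Lemma moment_integrand_le k m u : `|m| <= 8^-1 -> `|u ^+ k * ZT m w u| <= moment_dom k u.
Proof.
move=> m8; rewrite normrM normrX (ger0_norm (ltW (tilted_gt0 _ _ _ _ _))).
apply: (@le_trans _ _ (56 ^+ k * k`!%:R * expR (`|u| / 56) * ZT m w u)).
  by rewrite ler_wpM2r ?(ltW (tilted_gt0 _ _ _ _ _))// normr_exp_le_expR.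
rewrite -mulrA ler_wpM2l ?mulr_ge0 ?exprn_ge0//.
rewrite /tilted.
apply: (@le_trans _ _ (expR (xi u w) * expR `|7^-1 * u|)).
  rewrite -!expRD ler_expR normrM (@ger0_norm _ 7^-1) ?invr_ge0//.
  have : m * u <= 8^-1 * `|u| by apply: le_trans (ler_norm _) _; rewrite normrM ler_wpM2r.
  by lra.
by rewrite !expRD -mulrDr ler_wpM2l ?expR_ge0// mulNr expR_normr_le.
Qed.

Lemma measurable_moment_integrand k m : measurable_fun setT (fun u : R => u ^+ k * ZT m w u).
Proof.
apply: measurable_funM; last exact: (measurable_tilted hH hW).
exact: measurable_funX.
Qed.

Lemma moment_integrable k m : `|m| <= 8^-1 ->
  mu.-integrable setT (fun u => (u ^+ k * ZT m w u)%:E).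
Proof.
move=> m8; apply: le_integrable (moment_dom_integrable k) => //.
  by apply/measurable_EFinP; exact: measurable_moment_integrand.
move=> u _; rewrite !abse_EFin lee_fin (ger0_norm (moment_dom_ge0 _ _)).
exact: moment_integrand_le.
Qed.

Lemma moment_integrandD k u m : is_derive m (1 : R) (fun m => u ^+ k * ZT m w u)
  (u ^+ k.+1 * ZT m w u).
Proof.
rewrite /tilted.
apply: is_derive_eq.
by rewrite /GRing.scale /= exprS; ring.
Qed.

Let itv8P m : [set` `](- 8^-1 : R), 8^-1[] m -> `|m| <= 8^-1.
Proof. by rewrite /= in_itv/= => h; rewrite ltW// ltr_norml. Qed.

Lemma moment_derive k (m : R) : - 8^-1 < m < 8^-1 ->
  is_derive m (1 : R) (moment k ^~ w) (moment k.+1 m w).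
Proof.
move=> m8.
pose f (m u : R) := u ^+ k * ZT m w u.
have Im : [set` `](- 8^-1 : R), 8^-1[] m by rewrite /= in_itv.
have d1f x u : partial1of2 f x u = u ^+ k.+1 * ZT x w u.
  rewrite /partial1of2 derive1E; have D := moment_integrandD k u x; exact: derive_val.
have df x u : derivable (f ^~ u) x 1.
  have D := moment_integrandD k u x; exact: (@ex_derive _ _ _ _ _ _ _ D).
have hi x : [set` `](- 8^-1 : R), 8^-1[] x -> mu.-integrable setT (EFin \o f x).
  by move=> Ix; apply: moment_integrable; exact: itv8P.
have hb x u : [set` `](- 8^-1 : R), 8^-1[] x -> setT u -> `|partial1of2 f x u| <= moment_dom k.+1 u.
  by move=> Ix _; rewrite d1f; apply: moment_integrand_le; exact: itv8P.
have hd := @derivable_under_integral R _ _ mu f setT measurableT m (- 8^-1) (8^-1) Im hi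
  (fun x u _ _ => df x u) (moment_dom k.+1) (moment_dom_ge0 k.+1) (moment_dom_integrable k.+1) hb.
have he := @differentiation_under_integral R _ _ mu f setT measurableT m (- 8^-1) (8^-1) Im hi
  (fun x u _ _ => df x u) (moment_dom k.+1) (moment_dom_ge0 k.+1) (moment_dom_integrable k.+1) hb.
apply: DeriveDef => //.
rewrite -derive1E; transitivity (\int[mu]_(y in setT) (partial1of2 f ^~ y) m); first exact: he.
by rewrite /moment; apply: eq_Rintegral => u _; rewrite d1f.
Qed.

Hypothesis Jw : (J w < +oo)%E.

Lemma invsqrt_le_invsqrt01 m D : `|m| <= 6^-1 -> 0 < D -> (Zmass H W m w <= D%:E)%E ->
  (Num.sqrt D)^-1 <= expR 12^-1 * fine (J w).
Proof.
move=> m6 D0 hD.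
have Jf : J w \is a fin_num by rewrite ge0_fin_numE// invsqrt01_ge0.
rewrite -lee_fin EFinM fineK//.
have hD01 : (\int[leb]_(v in `[0%R, (0 + 1)%R]) (ZT m w v)%:E <= D%:E)%E.
  apply: le_trans hD; rewrite ZmassE; apply: ge0_subset_integral => //.
    by apply/measurable_EFinP; exact: (measurable_tilted hH hW).
  by move=> v _; rewrite lee_fin ltW// tilted_gt0.
apply: le_trans (invsqrt_jensen (measurable_tilted_exponent hH hW m w) D0 hD01) _.
rewrite add0r /invsqrt01.
have mJ : measurable_fun setT (fun v => expR (- (xi v w / 2))).
  by apply: (measurableT_comp (measurable_expR_log_Zproc hH hW) (g := fun v : R => (w, v))); exact: measurable_fun_pair.
have mJ' : measurable_fun [set` `[0%R : R, 1%R]] (fun v : R => (expR (- (xi v w / 2)))%:E).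
  by apply/measurable_EFinP; apply: measurable_funTS; exact: mJ.
rewrite -ge0_integralZl_EFin//; apply: ge0_le_integral => //.
- apply/measurable_EFinP/measurable_funTS; apply: measurableT_comp => //.
  apply: measurableT_comp => //; apply: measurable_funM => //.
  exact: (measurable_tilted_exponent hH hW).
- exact: measurable_funeM.
move=> v; rewrite /= in_itv/= => /andP[v0 v1].
rewrite -EFinM -expRD lee_fin ler_expR.
have : - (m * v) <= 6^-1.
  apply: le_trans (ler_norm _) _; rewrite normrN normrM -[leRHS]mulr1.
  by apply: ler_pM => //; rewrite ger0_norm.
by lra.
Qed.

Lemma Zmass_fin m : `|m| <= 6^-1 -> Zmass H W m w \is a fin_num.
Proof.
move=> m6; rewrite ge0_fin_numE; last first.
  by rewrite ZmassE; apply: integral_ge0 => u _; rewrite lee_fin ltW// tilted_gt0.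
by apply: le_lt_trans (Zmass_le hH hW m6 S0w) _; rewrite ltry.
Qed.

(** If the mass were null, [D = B ^- 2] would be admissible in the Jensen bound on [[0, 1]] and
    yield [B <= B - 1]. *)
Lemma moment0_gt0 m : `|m| <= 6^-1 -> 0 < moment 0 m w.
Proof.
move=> m6; rewrite moment0 ltNge; apply/negP => D0.
pose B := expR 12^-1 * fine (J w) + 1.
have B1 : 1 <= B by rewrite lerDr mulr_ge0 ?expR_ge0// fine_ge0// invsqrt01_ge0.
have B0 : 0 < B by lra.
have : (Num.sqrt (B ^- 2))^-1 <= expR 12^-1 * fine (J w).
  apply: (@invsqrt_le_invsqrt01 m) => //; first by rewrite invr_gt0 exprn_gt0.
  by rewrite -(fineK (Zmass_fin m6)) lee_fin (le_trans D0)// invr_ge0 exprn_ge0// ltW.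
have Bi : 0 <= B^-1 by rewrite invr_ge0 ltW.
rewrite -exprVn sqrtr_sqr (ger0_norm Bi) invrK /B.
by lra.
Qed.

Lemma invsqrt_moment0_le m : `|m| <= 6^-1 ->
  (Num.sqrt (moment 0 m w))^-1 <= expR 12^-1 * fine (J w).
Proof.
move=> m6; apply: (@invsqrt_le_invsqrt01 m) => //; first exact: moment0_gt0.
by rewrite moment0 fineK// Zmass_fin.
Qed.

Lemma sqrt_moment0_le m : `|m| <= 6^-1 ->
  Num.sqrt (moment 0 m w) <= expR 12^-1 * fine (S0 w).
Proof.
move=> m6; rewrite -(@ger0_norm _ (expR 12^-1 * _)); last first.
  by rewrite mulr_ge0 ?expR_ge0// fine_ge0// dom_mass_ge0.
rewrite -sqrtr_sqr ler_sqrt ?sqr_ge0// moment0 -lee_fin fineK ?Zmass_fin//.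
exact: (Zmass_le hH hW m6).
Qed.

(* The factor of [|u|^k] comes from absorbing it into [exp(|u|/48)], and
   [1/48 + (1/8)/2 = 1/12]. *)
Definition moment_cst (k : nat) : R := 48 ^+ k * k`!%:R * expR 12^-1 * expR 12^-1.

(** Here [1 / D] is split into two factors [D^{-1/2}]: one enters the integral over [u], where the
    local Jensen bound turns the integrand into [dom_weight]; the other is bounded by the Jensen
    integral over [[0, 1]]. *)
Lemma normr_moment_le k m : `|m| <= 8^-1 ->
  `|moment k m w| / moment 0 m w <= moment_cst k * (fine (S0 w) * fine (J w)).
Proof.
move=> m8; have m6 : `|m| <= 6^-1 by lra.
have D0 := moment0_gt0 m6; set D := moment 0 m w in D0 *.
set s := Num.sqrt D; have s0 : 0 < s by rewrite sqrtr_gt0.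
have Ds : D = s ^+ 2 by rewrite sqr_sqrtr// ltW.
have S0f : S0 w \is a fin_num by rewrite ge0_fin_numE// dom_mass_ge0.
suff h : `|moment k m w| / s <= 48 ^+ k * k`!%:R * expR 12^-1 * fine (S0 w).
  have -> : `|moment k m w| / D = (`|moment k m w| / s) * s^-1.
    by rewrite Ds; field; rewrite gt_eqF.
  have -> : moment_cst k * (fine (S0 w) * fine (J w)) =
    (48 ^+ k * k`!%:R * expR 12^-1 * fine (S0 w)) * (expR 12^-1 * fine (J w)).
    by rewrite /moment_cst; ring.
  apply: ler_pM => //; rewrite ?divr_ge0 ?invr_ge0 ?(ltW s0)//.
  exact: invsqrt_moment0_le.
have h1 : (`|moment k m w|%:E <= \int[leb]_u `|u ^+ k * ZT m w u|%:E)%E.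
  rewrite /moment EFin_normr_Rintegral//; last exact: moment_integrable.
  apply: le_abse_integral => //; apply/measurable_EFinP; exact: measurable_moment_integrand.
rewrite -lee_fin mulrC !EFinM (fineK S0f).
apply: (@le_trans _ _ (s^-1%:E * \int[leb]_u `|u ^+ k * ZT m w u|%:E)%E).
  by apply: lee_wpmul2l => //; rewrite lee_fin invr_ge0 ltW.
have mi : measurable_fun setT (fun u : R => `|u ^+ k * ZT m w u|).
  by apply: measurableT_comp => //; exact: measurable_moment_integrand.
have mdw : measurable_fun setT (dom_weight H W w).
  by apply: (measurableT_comp (measurable_dom_weight hH hW) (g := fun u : R => (w, u))); exact: measurable_fun_pair.
rewrite /dom_mass -EFinM -EFinM -ge0_integralZl_EFin//; last 2 first.
- exact/measurable_EFinP.
- by rewrite invr_ge0 ltW.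
rewrite -ge0_integralZl_EFin//; last by move=> u _; exact: dom_weight_ge0.
apply: ge0_le_integral => //.
- by move=> u _; rewrite -EFinM lee_fin mulr_ge0// invr_ge0 ltW.
- by apply: measurable_funeM; exact/measurable_EFinP.
- exact: measurable_funeM.
move=> u _.
have loc : (s^-1%:E <= (expR (12^-1 - m * u / 2))%:E * A0 w u)%E.
  apply: (invsqrt_le_local hH hW (c := u)) => //; first by rewrite lexx andbT; lra.
  rewrite /D moment0 fineK ?Zmass_fin// ZmassE; apply: ge0_subset_integral => //.
    by apply/measurable_EFinP; exact: (measurable_tilted hH hW).
  by move=> v _; rewrite lee_fin ltW// tilted_gt0.
apply: (@le_trans _ _ (`|u ^+ k * ZT m w u|%:E * ((expR (12^-1 - m * u / 2))%:E * A0 w u))%E).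
  by rewrite muleC; apply: lee_wpmul2l.
rewrite /dom_weight !muleA -!EFinM; apply: lee_wpmul2r; first exact: local_invsqrt_ge0.
rewrite lee_fin normrM normrX (ger0_norm (ltW (tilted_gt0 _ _ _ _ _))).
apply: (@le_trans _ _ (48 ^+ k * k`!%:R * expR (`|u| / 48) * ZT m w u * expR (12^-1 - m * u / 2))).
  rewrite ler_wpM2r ?expR_ge0// ler_wpM2r ?(ltW (tilted_gt0 _ _ _ _ _))//.
  exact: normr_exp_le_expR.
rewrite /tilted -!mulrA -!expRD; do 2 (rewrite ler_wpM2l ?exprn_ge0//).
rewrite ler_expR.
have : m * u <= 8^-1 * `|u| by apply: le_trans (ler_norm _) _; rewrite normrM ler_wpM2r.
by lra.
Qed.

End good_path.

End moments.

(** * Measurability of inverses and parameter integrals; reflection of Lebesgue measure *)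

(** The continuous functions [x / (x ^+ 2 + 1 / n.+1)] converge to the inverse everywhere, including
    at [0] with its convention [0^-1 = 0]. *)
Lemma measurable_invr (R : realType) : measurable_fun setT (fun x : R => x^-1).
Proof.
pose c n : R := n.+1%:R^-1.
have c0 n : 0 < c n by rewrite invr_gt0 ltr0n.
have d0 n (x : R) : 0 < x ^+ 2 + c n by rewrite ltr_wpDl// sqr_ge0.
apply: (@measurable_fun_cvg _ _ _ _ (fun n (x : R) => x * (x ^+ 2 + c n)^-1)) => //.
  move=> n; apply: continuous_measurable_fun => x.
  apply: cvgM; first exact: cvg_id.
  apply: cvgV; first by rewrite gt_eqF.
  by apply: cvgD; [exact: sqr_continuous|exact: cvg_cst].
move=> x _; have [->|x0] := eqVneq x 0.
  by rewrite invr0; under eq_fun do rewrite mul0r; exact: cvg_cst.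
have -> : x^-1 = x * (x ^+ 2 + 0)^-1 by rewrite addr0; field.
apply: cvgMl_tmp; apply: cvgV; first by rewrite addr0 sqrf_eq0.
by apply: cvgD; [exact: cvg_cst|exact: (@cvg_harmonic R)].
Qed.

Lemma measurable_funV d (T : measurableType d) (R : realType) (f : T -> R) :
  measurable_fun setT f -> measurable_fun setT (fun x => (f x)^-1).
Proof. by move=> mf; exact: (measurableT_comp (@measurable_invr R)). Qed.

Section reflection.
Context (R : realType).
Local Notation mu := (@lebesgue_measure R).

Let refl (t : R) : measurableTypeR R -> measurableTypeR R := fun s => t - s.

Let measurable_refl t : measurable_fun setT (refl t).
Proof. by apply: measurable_funB. Qed.

Lemma lebesgue_measure_refl (t : R) (A : set R) : measurable A ->
  mu ((fun s => t - s) @^-1` A) = mu A.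
Proof.
move=> mA; suff : pushforward mu (refl t) A = mu A by [].
apply/esym/lebesgue_measure_unique => //= _ [[a b]] _ <-.
rewrite /pushforward (_ : refl t @^-1` _ = [set` `[t - b, t - a[]); last first.
  by apply/seteqP; split => s /=; rewrite !in_itv/= /refl => /andP[h1 h2]; apply/andP; split; lra.
rewrite !lebesgue_measure_itv/= !lte_fin.
have -> : (t - b < t - a) = (a < b) by rewrite ltrD2l ltrN2.
case: ifPn => // _; rewrite -!EFinD; congr EFin; ring.
Qed.

Lemma ge0_integral_refl (t : R) (f : R -> \bar R) : measurable_fun setT f ->
  (forall s, 0 <= f s)%E -> (\int[mu]_s f (t - s)%R = \int[mu]_s f s)%E.
Proof.
move=> mf f0.
transitivity (\int[pushforward mu (refl t)]_s f s)%E.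
  by rewrite ge0_integral_pushforward.
apply: eq_measure_integral => A mA _; exact: lebesgue_measure_refl.
Qed.

Lemma integral_refl (t : R) (f : R -> R) : measurable_fun setT f ->
  (\int[mu]_s (f (t - s)%R)%:E = \int[mu]_s (f s)%:E)%E.
Proof.
move=> mf; have mE : measurable_fun setT (fun s : R => (f s)%:E) by exact/measurable_EFinP.
rewrite integralE [RHS]integralE; congr (_ - _)%E.
  rewrite -[RHS](ge0_integral_refl t (measurable_funepos mE) (funepos_ge0 _)).
  by apply: eq_integral => s _; rewrite !funeposE.
rewrite -[RHS](ge0_integral_refl t (measurable_funeneg mE) (funeneg_ge0 _)).
by apply: eq_integral => s _; rewrite !funenegE.
Qed.

End reflection.

Lemma measurable_fun_integral_param d (T : measurableType d) (R : realType) (g : T * R -> R) :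
  measurable_fun setT g -> measurable_fun setT (fun w => \int[leb]_u (g (w, u))%:E)%E.
Proof.
move=> mg; have mg' : measurable_fun setT (fun p => (g p)%:E) by exact/measurable_EFinP.
rewrite (_ : (fun w => _) = (fun w => (\int[leb]_u (fun p => (g p)%:E)^\+ (w, u) -
   \int[leb]_u (fun p => (g p)%:E)^\- (w, u))%E)).
  apply: emeasurable_funB.
    apply: (@measurable_fun_fubini_tonelli_F _ _ T _ R leb (fun p => (g p)%:E)^\+%E) => //.
    exact: measurable_funepos.
  apply: (@measurable_fun_fubini_tonelli_F _ _ T _ R leb (fun p => (g p)%:E)^\-%E) => //.
  exact: measurable_funeneg.
apply/funext => w; rewrite integralE; congr (_ - _)%E; apply: eq_integral => u _.
  by rewrite !funeposE.
by rewrite !funenegE.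
Qed.

Section good_set.
Context d (T : measurableType d) (R : realType) (P : probability T R).
Variables (H : R) (W : R -> T -> R).
Hypothesis hH : 1 / 2 <= H <= 1.
Hypothesis hW : is_fBM P H W.
Local Notation S0 := (dom_mass H W).
Local Notation J := (invsqrt01 H W).
Local Notation ZT := (tilted H W).
Local Notation M := (moment H W).

(* Off this null set the extended integrals may be infinite, and [fine] gives [0]. *)
Definition good : set T := [set w | (S0 w < +oo)%E /\ (J w < +oo)%E].

Let mS := measurable_dom_mass hH hW.
Let mJ := measurable_invsqrt01 hH hW.

Lemma measurable_good : measurable good.
Proof.
have h (f : T -> \bar R) : measurable_fun setT f -> measurable [set w | f w < +oo]%E.
  move=> mf; rewrite -[X in measurable X]setTI; exact: emeasurable_fun_infty_o.
by apply: measurableI; exact: h.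
Qed.

Lemma dom_mass_integrable : P.-integrable setT S0.
Proof.
apply/integrableP; split => //.
under eq_integral do rewrite gee0_abs ?dom_mass_ge0//.
apply: le_lt_trans (dom_mass_mean_le hH hW) (dom_const_lty hH).
Qed.

Lemma invsqrt01_integrable : P.-integrable setT J.
Proof.
apply/integrableP; split => //.
under eq_integral do rewrite gee0_abs ?invsqrt01_ge0//.
by apply: le_lt_trans (invsqrt01_mean_le hH hW) _; rewrite ltry.
Qed.

Lemma goodC0 : P (~` good) = 0%E.
Proof.
apply: measure_negligible; first exact/measurableC/measurable_good.
apply: (@negligibleS _ _ _ _ (~` [set w | setT w -> S0 w \is a fin_num] `|`
   ~` [set w | setT w -> J w \is a fin_num])).
  move=> w /not_andP[] h; [left|right] => /(_ Logic.I).
    by rewrite ge0_fin_numE ?dom_mass_ge0.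
  by rewrite ge0_fin_numE ?invsqrt01_ge0.
apply: negligibleU.
  exact: (integrable_ae measurableT dom_mass_integrable).
exact: (integrable_ae measurableT invsqrt01_integrable).
Qed.

Lemma fineM_le (a b : \bar R) : (0 <= a)%E -> (0 <= b)%E -> ((fine a * fine b)%:E <= a * b)%E.
Proof.
move: a b => [a| |] [b| |]//= a0 b0; rewrite ?mul0r ?mulr0 ?mule_ge0//.
Qed.

Lemma fine_dom_integrable : P.-integrable setT (fun w => (fine (S0 w) + fine (J w))%:E).
Proof.
have key (f : T -> \bar R) : (forall w, 0 <= f w)%E -> P.-integrable setT f ->
   P.-integrable setT (fun w => (fine (f w))%:E).
  move=> f0 fi; have mf := measurable_int _ fi; apply: le_integrable fi => //.
    by apply/measurable_EFinP; apply: measurableT_comp.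
  by move=> w _; rewrite !gee0_abs ?lee_fin ?fine_ge0//; case: (f w) (f0 w).
under eq_fun do rewrite EFinD; apply: integrableD => //.
  by apply: key; [exact: dom_mass_ge0|exact: dom_mass_integrable].
by apply: key; [exact: invsqrt01_ge0|exact: invsqrt01_integrable].
Qed.

Lemma fine_domM_integrable : P.-integrable setT (fun w => (fine (S0 w) * fine (J w))%:E).
Proof.
apply: (@le_integrable _ _ _ _ _ measurableT _ (fun w => J w * S0 w)%E).
- by apply/measurable_EFinP; apply: measurable_funM; apply: measurableT_comp.
- move=> w _; rewrite !gee0_abs ?mule_ge0 ?lee_fin ?mulr_ge0 ?fine_ge0 ?dom_mass_ge0 ?invsqrt01_ge0//.
  by rewrite muleC fineM_le ?dom_mass_ge0 ?invsqrt01_ge0.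
apply/integrableP; split; first exact: emeasurable_funM.
under eq_integral do rewrite gee0_abs ?mule_ge0 ?dom_mass_ge0 ?invsqrt01_ge0//.
exact: le_lt_trans (dom_mass_invsqrt01_mean_le hH hW) (dom_const_lty hH).
Qed.

Lemma measurable_moment k m : measurable_fun setT (M k m).
Proof.
apply: (measurableT_comp (f := fine)) => //.
apply: (@measurable_fun_integral_param _ T R (fun p => p.2 ^+ k * ZT m p.1 p.2)).
apply: measurable_funM; last exact: (measurable_tilted_joint hH hW).
by apply: measurable_funX.
Qed.

Definition tilted_mean m w := M 1 m w / M 0 m w.
Definition tilted_var m w := M 2 m w / M 0 m w - tilted_mean m w ^+ 2.
Local Notation zt := tilted_mean.
Local Notation Vt := tilted_var.

Lemma measurable_tilted_mean m : measurable_fun setT (zt m).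
Proof.
apply: measurable_funM; first exact: measurable_moment.
by apply: measurable_funV; exact: measurable_moment.
Qed.

Lemma measurable_tilted_var m : measurable_fun setT (Vt m).
Proof.
apply: measurable_funB; last by apply: measurable_funX; exact: measurable_tilted_mean.
apply: measurable_funM; first exact: measurable_moment.
by apply: measurable_funV; exact: measurable_moment.
Qed.

Lemma logZmassE m w : logZmass H W m w = ln (M 0 m w).
Proof. by rewrite /logZmass moment0. Qed.

Lemma measurable_logZmass m : measurable_fun setT (logZmass H W m).
Proof.
rewrite (_ : logZmass H W m = fun w => ln (M 0 m w)).
  by apply: measurableT_comp => //; exact: measurable_moment.
by apply/funext => w; exact: logZmassE.
Qed.

Section on_good.
Variable w : T.
Hypothesis gw : good w.
Let S0w : (S0 w < +oo)%E. Proof. by case: gw. Qed.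
Let Jw : (J w < +oo)%E. Proof. by case: gw. Qed.

Lemma good_moment0_gt0 m : `|m| <= 6^-1 -> 0 < M 0 m w.
Proof. exact: (moment0_gt0 hH hW S0w Jw). Qed.

Lemma good_quadratic m a : `|m| <= 8^-1 ->
  (\int[leb]_u ((u - a) ^+ 2 * ZT m w u)%:E =
   (M 2 m w - 2 * a * M 1 m w + a ^+ 2 * M 0 m w)%:E)%E.
Proof.
move=> m8.
have i k := moment_integrable hH hW S0w k m8.
have I k : (\int[leb]_u (u ^+ k * ZT m w u)%:E = (M k m w)%:E)%E.
  by rewrite /moment /Rintegral fineK//; exact: integrable_fin_num.
transitivity (\int[leb]_u ((u ^+ 2 * ZT m w u)%:E +
   ((- (2 * a))%:E * (u ^+ 1 * ZT m w u)%:E + (a ^+ 2)%:E * (u ^+ 0 * ZT m w u)%:E)))%E.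
  apply: eq_integral => u _; rewrite -!EFinM -!EFinD; congr EFin.
  by rewrite expr1 expr0; ring.
have j k c : leb.-integrable setT (fun u => c%:E * (u ^+ k * ZT m w u)%:E)%E.
  exact: integrableZl.
rewrite integralD//; last exact: integrableD.
rewrite integralD// !integralZl// !I -!EFinM -!EFinD; congr EFin.
ring.
Qed.

Lemma tilted_var_ge0 m : `|m| <= 8^-1 -> 0 <= Vt m w.
Proof.
move=> m8; have m6 : `|m| <= 6^-1 by lra.
have D0 := good_moment0_gt0 m6.
have h : 0 <= M 2 m w - 2 * zt m w * M 1 m w + zt m w ^+ 2 * M 0 m w.
  rewrite -lee_fin -good_quadratic//; apply: integral_ge0 => u _.
  by rewrite lee_fin mulr_ge0 ?sqr_ge0// ltW// tilted_gt0.
have -> : Vt m w = (M 2 m w - 2 * zt m w * M 1 m w + zt m w ^+ 2 * M 0 m w) / M 0 m w.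
  by rewrite /tilted_var /tilted_mean; field; rewrite gt_eqF.
by rewrite divr_ge0// ltW.
Qed.

Lemma tilted_mean_le m : `|m| <= 8^-1 ->
  `|zt m w| <= moment_cst R 1 * (fine (S0 w) * fine (J w)).
Proof.
move=> m8; have m6 : `|m| <= 6^-1 by lra.
rewrite normrM normfV (gtr0_norm (good_moment0_gt0 m6)).
exact: (normr_moment_le hH hW S0w Jw).
Qed.

(** Nonnegativity of the variance allows the squared mean to be dropped. Bounding that square
    separately would bring in [(S0 * J) ^+ 2], whose integrability is not established. *)
Lemma tilted_var_le m : `|m| <= 8^-1 ->
  `|Vt m w| <= moment_cst R 2 * (fine (S0 w) * fine (J w)).
Proof.
move=> m8; have m6 : `|m| <= 6^-1 by lra.
rewrite ger0_norm ?tilted_var_ge0//.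
apply: le_trans (normr_moment_le hH hW S0w Jw 2 m8).
apply: (@le_trans _ _ (M 2 m w / M 0 m w)); first by rewrite gerBl sqr_ge0.
by rewrite ler_wpM2r ?ler_norm// invr_ge0 ltW// good_moment0_gt0.
Qed.

(** With [s = sqrt D], [|ln D| = 2 |ln s| <= 2 (s + s^-1)], and both terms have integrable
    majorants. *)
Lemma logZmass_le m : `|m| <= 6^-1 ->
  `|logZmass H W m w| <= 2 * expR 12^-1 * (fine (S0 w) + fine (J w)).
Proof.
move=> m6; rewrite logZmassE; have D0 := good_moment0_gt0 m6.
have := sqrt_moment0_le hH hW S0w m6; have := invsqrt_moment0_le hH hW S0w Jw m6.
set s := Num.sqrt _ => h1 h2.
have s0 : 0 < s by rewrite sqrtr_gt0.
have -> : M 0 m w = s ^+ 2 by rewrite sqr_sqrtr// ltW.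
rewrite lnXn// mulr2n.
have l1 : ln s < s by exact: ln_sublinear.
have l2 : - ln s < s^-1 by rewrite -lnV ?posrE//; apply: ln_sublinear; rewrite invr_gt0.
have si : 0 < s^-1 by rewrite invr_gt0.
have -> : 2 * expR 12^-1 * (fine (S0 w) + fine (J w)) =
  2 * (expR 12^-1 * fine (S0 w)) + 2 * (expR 12^-1 * fine (J w)) by ring.
by rewrite ler_norml; apply/andP; split; lra.
Qed.

End on_good.

End good_set.

(** * The variance identity *)

Section path_functionals.
Context (R : realType).
Local Notation E := (cpath_space R).
Implicit Types x : E.

Definition path_mass x : R := fine (\int[leb]_s (expR ((x : cpath R) s))%:E)%E.
Definition path_first x : R := fine (\int[leb]_s (s * expR ((x : cpath R) s))%:E)%E.
(** [(zeta + c)^2 q_t] as a functional of the path [log Z]. *)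
Definition path_functional (t c : R) x : R :=
  (path_first x / path_mass x + c) ^+ 2 * (expR ((x : cpath R) t) / path_mass x).

Let mexp : measurable_fun setT (fun p : E * R => expR ((p.1 : cpath R) p.2)).
Proof. by apply: measurableT_comp => //; exact: measurable_cpath_joint. Qed.

Lemma measurable_path_mass : measurable_fun setT path_mass.
Proof.
apply: (measurableT_comp (f := fine)) => //.
exact: (@measurable_fun_integral_param _ E R (fun p => expR ((p.1 : cpath R) p.2))).
Qed.

Lemma measurable_path_first : measurable_fun setT path_first.
Proof.
apply: (measurableT_comp (f := fine)) => //.
apply: (@measurable_fun_integral_param _ E R (fun p => p.2 * expR ((p.1 : cpath R) p.2))).
exact: measurable_funM.
Qed.

Lemma measurable_path_functional t c : measurable_fun setT (path_functional t c).
Proof.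
have mV : measurable_fun setT (fun x => (path_mass x)^-1).
  by apply: measurable_funV; exact: measurable_path_mass.
apply: measurable_funM; last first.
  by apply: measurable_funM => //; apply: measurableT_comp => //; exact: measurable_cpath_eval.
apply: measurable_funX; apply: measurable_funD => //.
by apply: measurable_funM => //; exact: measurable_path_first.
Qed.

Lemma path_functional_ge0 t c x : 0 <= path_functional t c x.
Proof.
rewrite mulr_ge0 ?sqr_ge0// divr_ge0 ?expR_ge0//.
by apply: fine_ge0; apply: integral_ge0 => s _; rewrite lee_fin expR_ge0.
Qed.

End path_functionals.

Section identity.
Context d (T : measurableType d) (R : realType) (P : probability T R).
Variables (H : R) (W : R -> T -> R).
Hypothesis hH : 1 / 2 <= H <= 1.
Hypothesis hW : is_fBM P H W.
Local Notation xi := (log_Zproc H W).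
Local Notation ZT := (tilted H W 0).
Local Notation M k := (moment H W k 0).
Local Notation zt := (tilted_mean H W 0).
Local Notation Vt := (tilted_var H W 0).
Local Notation good := (good H W).

Let H0 : 0 < H. Proof. by move: hH => /andP[h1 h2]; lra. Qed.
Let abs06 : `|0 : R| <= 6^-1. Proof. by rewrite normr0 invr_ge0. Qed.
Let abs08 : `|0 : R| <= 8^-1. Proof. by rewrite normr0 invr_ge0. Qed.

Let ZTE w s : ZT w s = expR (xi s w).
Proof. by rewrite /tilted mul0r addr0. Qed.

Section fixed.
Variable w : T.
Hypothesis gw : good w.
Let D0 : 0 < M 0 w. Proof. exact: (good_moment0_gt0 hH hW gw). Qed.
Let IM k : (\int[leb]_u (u ^+ k * ZT w u)%:E = (M k w)%:E)%E.
Proof.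
rewrite /moment /Rintegral fineK//; apply: integrable_fin_num => //.
by apply: (moment_integrable hH hW) => //; case: gw.
Qed.
Let iM k : leb.-integrable setT (fun u => (u ^+ k * ZT w u)%:E).
Proof. by apply: (moment_integrable hH hW) => //; case: gw. Qed.

Let cont t := @reversed_log_ratio_continuous _ _ _ P H W H0 hW t.

Lemma path_functional_false (t c : R) :
  path_functional t c (path_of (@cont t) false w) = (zt w + c) ^+ 2 * (ZT w t / M 0 w).
Proof.
have m0 : path_mass (path_of (@cont t) false w) = M 0 w.
  rewrite /path_mass /moment /Rintegral; congr fine; apply: eq_integral => s _ /=.
  by rewrite expr0 mul1r ZTE.
have m1 : path_first (path_of (@cont t) false w) = M 1 w.
  rewrite /path_first /moment /Rintegral; congr fine; apply: eq_integral => s _ /=.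
  by rewrite expr1 ZTE.
by rewrite /path_functional m0 m1 /= ZTE.
Qed.

(** On the reversed path the mean becomes [t - zt w]. The density at time [t] becomes
    [Z_0 / M 0 w = 1 / M 0 w], because the factor [Z_t^{-1}] cancels between numerator and mass; the
    weight [Z_t] makes it the density of the original path at [t]. *)
Lemma path_functional_true (t c : R) :
  Zproc H W t w * path_functional t c (path_of (@cont t) true w) =
  (t - zt w + c) ^+ 2 * (ZT w t / M 0 w).
Proof.
have mxi : measurable_fun setT (fun s => expR (xi s w - xi t w)).
  apply: continuous_measurable_fun => s.
  apply: (@continuous_cvg _ _ _ _ _ (fun s => xi s w - xi t w)); first exact: continuous_expR.
  by apply: cvgB; [exact: (log_Zproc_continuous H0 hW)|exact: cvg_cst].
set e := expR (- xi t w).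
have eE s : expR (xi s w - xi t w) = e * ZT w s by rewrite expRD mulrC ZTE.
have m0 : path_mass (path_of (@cont t) true w) = e * M 0 w.
  rewrite /path_mass -[RHS]/(fine (e * M 0 w)%:E); congr fine.
  rewrite -[LHS]/(\int[leb]_s ((fun s => expR (xi s w - xi t w)) (t - s)%R)%:E)%E.
  rewrite integral_refl// EFinM -IM -integralZl//.
  by apply: eq_integral => s _; rewrite eE expr0 mul1r EFinM.
have m1 : path_first (path_of (@cont t) true w) = e * (t * M 0 w - M 1 w).
  rewrite /path_first -[RHS]/(fine (e * (t * M 0 w - M 1 w))%:E); congr fine.
  transitivity (\int[leb]_s ((fun s => (t - s) * expR (xi s w - xi t w)) (t - s)%R)%:E)%E.
    by apply: eq_integral => s _ /=; congr (_ * _)%:E; ring.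
  have mg : measurable_fun setT (fun s : R => (t - s) * expR (xi s w - xi t w)).
    by apply: measurable_funM => //; apply: measurable_funB.
  apply: (etrans (integral_refl t mg)).
  transitivity (\int[leb]_s ((e * t)%:E * (s ^+ 0 * ZT w s)%:E - e%:E * (s ^+ 1 * ZT w s)%:E))%E.
    apply: eq_integral => s _; rewrite -!EFinM -EFinN -EFinD; congr EFin.
    by rewrite eE expr0 expr1; ring.
  rewrite integralB//; [|exact: integrableZl|exact: integrableZl].
  by rewrite !integralZl// !IM -!EFinM -EFinN -EFinD; congr EFin; ring.
rewrite /path_functional m0 m1 /= subrr (log_Zproc0 hH hW) sub0r -/e.
have e0 : e != 0 by rewrite gt_eqF// expR_gt0.
have -> : e * (t * M 0 w - M 1 w) / (e * M 0 w) = t - zt w.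
  by rewrite /tilted_mean; field; rewrite e0 gt_eqF.
rewrite ZTE ZprocE -/(xi t w) mulrCA; congr (_ * _).
have -> : expR (xi t w) = e^-1 by rewrite /e expRN invrK.
by field; rewrite e0 gt_eqF.
Qed.

Lemma quadratic_mean a :
  (\int[leb]_t ((t - a) ^+ 2 * (ZT w t / M 0 w))%:E =
   (Vt w + (zt w - a) ^+ 2)%:E)%E.
Proof.
transitivity (\int[leb]_t ((M 0 w)^-1%:E * ((t - a) ^+ 2 * ZT w t)%:E))%E.
  by apply: eq_integral => t _; rewrite -EFinM; congr EFin; ring.
rewrite ge0_integralZl_EFin//; last 3 first.
- by move=> t _; rewrite lee_fin mulr_ge0 ?sqr_ge0// ltW// tilted_gt0.
- apply/measurable_EFinP; apply: measurable_funM; last exact: (measurable_tilted hH hW).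
  by apply: measurable_funX; apply: measurable_funB.
- by rewrite invr_ge0 ltW.
rewrite (good_quadratic hH hW gw)// -EFinM; congr EFin.
by rewrite /tilted_var /tilted_mean; field; rewrite gt_eqF.
Qed.

Lemma constant_mean a :
  (\int[leb]_t (a ^+ 2 * (ZT w t / M 0 w))%:E = (a ^+ 2)%:E)%E.
Proof.
transitivity (\int[leb]_t ((a ^+ 2 / M 0 w)%:E * (t ^+ 0 * ZT w t)%:E))%E.
  by apply: eq_integral => t _; rewrite -EFinM; congr EFin; rewrite expr0; ring.
rewrite integralZl// IM -EFinM; congr EFin.
by field; rewrite gt_eqF.
Qed.

End fixed.

Let ae_good (f g : T -> \bar R) : (forall w, good w -> f w = g w) -> ae_eq P setT f g.
Proof.
move=> fg; exists (~` good); split.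
- exact/measurableC/(measurable_good hH hW).
- exact: (goodC0 hH hW).
- by move=> w /= /not_implyP[_]; apply: contra_not => /fg.
Qed.

Let mgood : measurable_fun setT (\1_good : T -> R).
Proof. exact/measurable_indic/(measurable_good hH hW). Qed.

Let mM k := measurable_moment hH hW k 0.
Let mzt := measurable_tilted_mean hH hW 0.

Let mq : measurable_fun setT (fun p : T * R => ZT p.1 p.2 / M 0 p.1).
Proof.
apply: measurable_funM; first exact: (measurable_tilted_joint hH hW).
by apply: (measurableT_comp (measurable_funV (mM 0))).
Qed.

Let q_ge0 w t : 0 <= ZT w t / M 0 w.
Proof.
rewrite divr_ge0//; first by rewrite ltW// tilted_gt0.
rewrite moment0 fine_ge0// ZmassE; apply: integral_ge0 => u _.
by rewrite lee_fin ltW// tilted_gt0.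
Qed.

(** The indicator of [good] makes the integral over time explicit at every [w]; the comparison of
    laws is then an equality almost everywhere. *)
Definition shifted_sqr (c : R) (p : T * R) : R :=
  \1_good p.1 * ((p.2 - zt p.1 + c) ^+ 2 * (ZT p.1 p.2 / M 0 p.1)).
Definition mean_sqr (c : R) (p : T * R) : R :=
  \1_good p.1 * ((zt p.1 + c) ^+ 2 * (ZT p.1 p.2 / M 0 p.1)).

Let m_ss c : measurable_fun setT (shifted_sqr c).
Proof.
apply: measurable_funM; first exact: (measurableT_comp mgood).
apply: measurable_funM => //; apply: measurable_funX; apply: measurable_funD => //.
by apply: measurable_funB => //; exact: (measurableT_comp mzt).
Qed.

Let m_ms c : measurable_fun setT (mean_sqr c).
Proof.
apply: measurable_funM; first exact: (measurableT_comp mgood).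
apply: measurable_funM => //; apply: measurable_funX; apply: measurable_funD => //.
exact: (measurableT_comp mzt).
Qed.

Let ss_ge0 c p : 0 <= shifted_sqr c p.
Proof. by rewrite mulr_ge0// mulr_ge0// sqr_ge0. Qed.

Let ms_ge0 c p : 0 <= mean_sqr c p.
Proof. by rewrite mulr_ge0// mulr_ge0// sqr_ge0. Qed.

Lemma shifted_sqr_mean t c :
  (\int[P]_w (shifted_sqr c (w, t))%:E = \int[P]_w (mean_sqr c (w, t))%:E)%E.
Proof.
pose cont := @reversed_log_ratio_continuous _ _ _ P H W H0 hW t.
have mF := @measurable_path_functional R t c.
have mp b : measurable_fun setT (path_of (@cont) b).
  by apply: measurable_path_of => b' s; exact: (measurable_reversed_log_ratio hW).
have := fbm_tilt_integral H0 hW t mF (@path_functional_ge0 R t c).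
have -> : (\int[P]_w (shifted_sqr c (w, t))%:E =
  \int[P]_w (Zproc H W t w * path_functional t c (path_of (@cont) true w))%:E)%E.
  apply: ge0_ae_eq_integral => //.
  - apply/measurable_EFinP.
    by apply: (measurableT_comp (m_ss c) (g := fun w : T => (w, t))); exact: measurable_fun_pair.
  - apply/measurable_EFinP; apply: measurable_funM; last exact: (measurableT_comp mF).
    have h : measurable_fun setT (fun w => expR (xi t w)).
      by apply: measurableT_comp => //; exact: (measurable_log_Zproc hW).
    exact: h.
  - by move=> w _; rewrite lee_fin.
  - by move=> w _; rewrite lee_fin; apply: mulr_ge0; [exact: expR_ge0|exact: path_functional_ge0].
  - apply: ae_good => w gw; congr EFin; rewrite (path_functional_true gw) /shifted_sqr /=.
    by rewrite indicE mem_set// mul1r.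
move=> ->; apply: ge0_ae_eq_integral => //.
- by apply/measurable_EFinP; exact: (measurableT_comp mF).
- apply/measurable_EFinP.
  by apply: (measurableT_comp (m_ms c) (g := fun w : T => (w, t))); exact: measurable_fun_pair.
- by move=> w _; rewrite lee_fin path_functional_ge0.
- by move=> w _; rewrite lee_fin.
- apply: ae_good => w gw; congr EFin; rewrite path_functional_false /mean_sqr /=.
  by rewrite indicE mem_set// mul1r.
Qed.

Lemma tilted_var_mean_identity c :
  (\int[P]_w (\1_good w * (Vt w + c ^+ 2))%:E = \int[P]_w (\1_good w * (zt w + c) ^+ 2)%:E)%E.
Proof.
have E1 w : (\int[leb]_t (shifted_sqr c (w, t))%:E = (\1_good w * (Vt w + c ^+ 2))%:E)%E.
  rewrite /shifted_sqr /= indicE; have [/set_mem gw|ng] := boolP (w \in good); last first.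
    by rewrite mul0r; apply: integral0_eq => t _; rewrite mul0r.
  (* [quadratic_mean] is applied at the centre [zt w - c]. *)
  rewrite mul1r -[c in RHS](_ : zt w - (zt w - c) = c); last by ring.
  rewrite -(quadratic_mean gw); apply: eq_integral => t _; rewrite mul1r; congr EFin.
  by congr (_ ^+ 2 * _); ring.
have E2 w : (\int[leb]_t (mean_sqr c (w, t))%:E = (\1_good w * (zt w + c) ^+ 2)%:E)%E.
  rewrite /mean_sqr /= indicE; have [/set_mem gw|ng] := boolP (w \in good); last first.
    by rewrite mul0r; apply: integral0_eq => t _; rewrite mul0r.
  by rewrite mul1r -(constant_mean gw); apply: eq_integral => t _; rewrite mul1r.
(* The integrands are nonnegative, so Tonelli exchanges the two integrals without any integrability
   of [zt ^+ 2]. *)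
under eq_integral do rewrite -E1; under [RHS]eq_integral do rewrite -E2.
rewrite (@fubini_tonelli _ _ T _ R P leb (fun p => (shifted_sqr c p)%:E)); last 2 first.
- by apply/measurable_EFinP; exact: m_ss.
- by move=> p; rewrite lee_fin.
rewrite (@fubini_tonelli _ _ T _ R P leb (fun p => (mean_sqr c p)%:E)); last 2 first.
- by apply/measurable_EFinP; exact: m_ms.
- by move=> p; rewrite lee_fin.
by apply: eq_integral => t _; exact: shifted_sqr_mean.
Qed.

End identity.

(** * Differentiation of the expected logarithm *)

Section expected_log_mass.
Context d (T : measurableType d) (R : realType) (P : probability T R).
Variables (H : R) (W : R -> T -> R).
Hypothesis hH : 1 / 2 <= H <= 1.
Hypothesis hW : is_fBM P H W.
Local Notation S0 := (dom_mass H W).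
Local Notation J := (invsqrt01 H W).
Local Notation M := (moment H W).
Local Notation L := (logZmass H W).
Local Notation zt := (tilted_mean H W).
Local Notation Vt := (tilted_var H W).
Local Notation good := (good H W).

Let I8 : set R := [set` `](- 8^-1), 8^-1[].

Let I8P m : I8 m -> `|m| <= 8^-1.
Proof. by rewrite /I8 /= in_itv/= => h; rewrite ltW// ltr_norml. Qed.

Let I8P6 m : I8 m -> `|m| <= 6^-1.
Proof. by move=> /I8P h; apply: le_trans h _; lra. Qed.

Let I8lt m : I8 m -> - 8^-1 < m < 8^-1.
Proof. by rewrite /I8 /= in_itv. Qed.

Let mgood := measurable_good hH hW.

Section pathwise_derivatives.
Variable w : T.
Hypothesis gw : good w.
Let S0w : (S0 w < +oo)%E. Proof. by case: gw. Qed.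

Lemma logZmass_derive m : I8 m -> is_derive m (1 : R) (fun m => L m w) (zt m w).
Proof.
move=> Im; have D0 := good_moment0_gt0 hH hW gw (I8P6 Im).
have dM := moment_derive hH hW S0w 0 (I8lt Im).
rewrite (_ : (fun m => L m w) = (@ln R) \o (M 0 ^~ w)); last first.
  by apply/funext => m'; rewrite /= logZmassE.
have dl := is_derive1_ln D0.
apply: is_derive_eq.
by rewrite /tilted_mean mulrC.
Qed.

Lemma tilted_mean_derive m : I8 m -> is_derive m (1 : R) (zt ^~ w) (Vt m w).
Proof.
move=> Im; have D0 := good_moment0_gt0 hH hW gw (I8P6 Im).
have d0 := moment_derive hH hW S0w 0 (I8lt Im).
have d1 := moment_derive hH hW S0w 1 (I8lt Im).
have D0' : M 0 m w != 0 by rewrite gt_eqF.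
have dV := is_deriveV D0' d0.
rewrite (_ : zt ^~ w = (M 1 ^~ w) * (fun y => (M 0 y w)^-1)); last by apply/funext.
apply: (is_derive_eq (is_deriveM d1 dV)).
rewrite /GRing.scale /= /tilted_var /tilted_mean.
by field.
Qed.

Lemma tilted_var_continuous : {in I8, continuous (Vt ^~ w)}.
Proof.
move=> m /set_mem Im.
have D0 := good_moment0_gt0 hH hW gw (I8P6 Im).
have cont (f : R -> R) a : is_derive m (1 : R) f a -> {for m, continuous f}.
  by move=> D; apply/differentiable_continuous/derivable1_diffP; exact: (@ex_derive _ _ _ _ _ _ _ D).
have c0 := cont _ _ (moment_derive hH hW S0w 0 (I8lt Im)).
have c2 := cont _ _ (moment_derive hH hW S0w 2 (I8lt Im)).
have cz := cont _ _ (tilted_mean_derive Im).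
rewrite /continuous_at /tilted_var.
apply: cvgB; first by apply: cvgM => //; apply: cvgV => //; rewrite gt_eqF.
rewrite expr2; under eq_fun do rewrite expr2.
exact: cvgM.
Qed.

End pathwise_derivatives.

(** On [good] the pathwise derivatives exist and are dominated at every point, as differentiation
    under the integral requires; the null complement is restored by [integral_good]. *)
Definition mean_on_good (X : R -> T -> R) (m : R) : R := \int[P]_(w in good) X m w.

Let dom1 w : R := fine (S0 w) * fine (J w).

Let dom1_ge0 w : 0 <= dom1 w.
Proof. by rewrite mulr_ge0// fine_ge0// ?dom_mass_ge0 ?invsqrt01_ge0. Qed.

Let i_dom k : P.-integrable good (EFin \o (fun w => moment_cst R k * dom1 w)).
Proof.
apply: (@integrableS _ _ _ P setT) => //.
rewrite /comp; under eq_fun do rewrite EFinM.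
apply: integrableZl => //; exact: (fine_domM_integrable hH hW).
Qed.

Let dom_ge0 k w : 0 <= moment_cst R k * dom1 w.
Proof. by rewrite mulr_ge0// /moment_cst !mulr_ge0 ?exprn_ge0 ?expR_ge0. Qed.

Let good_integrable (X : T -> R) (Y : T -> R) : measurable_fun setT X ->
  P.-integrable good (EFin \o Y) -> (forall w, good w -> `|X w| <= Y w) ->
  P.-integrable good (EFin \o X).
Proof.
move=> mX iY XY; apply: le_integrable iY => //.
  by apply/measurable_EFinP; exact: measurable_funTS.
move=> w gw; rewrite /= lee_fin; apply: le_trans (XY _ gw) (ler_norm _).
Qed.

Lemma logZmass_good_integrable m : I8 m -> P.-integrable good (EFin \o L m).
Proof.
move=> Im; apply: (@good_integrable _ (fun w => 2 * expR 12^-1 * (fine (S0 w) + fine (J w)))).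
- exact: (measurable_logZmass hH hW).
- apply: (@integrableS _ _ _ P setT) => //; rewrite /comp; under eq_fun do rewrite EFinM.
  apply: integrableZl => //; exact: (fine_dom_integrable hH hW).
- by move=> w gw; exact: (logZmass_le hH hW gw (I8P6 Im)).
Qed.

Lemma tilted_mean_good_integrable m : I8 m -> P.-integrable good (EFin \o zt m).
Proof.
move=> Im; apply: (good_integrable _ (i_dom 1)); first exact: (measurable_tilted_mean hH hW).
by move=> w gw; exact: (tilted_mean_le hH hW gw (I8P Im)).
Qed.

Lemma tilted_var_good_integrable m : I8 m -> P.-integrable good (EFin \o Vt m).
Proof.
move=> Im; apply: (good_integrable _ (i_dom 2)); first exact: (measurable_tilted_var hH hW).
by move=> w gw; exact: (tilted_var_le hH hW gw (I8P Im)).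
Qed.

Lemma mean_on_good_derive (X X' : R -> T -> R) (Y : T -> R) m : I8 m ->
  (forall m, I8 m -> P.-integrable good (EFin \o X m)) ->
  (forall m w, I8 m -> good w -> is_derive m (1 : R) (X ^~ w) (X' m w)) ->
  (forall w, 0 <= Y w) -> P.-integrable good (EFin \o Y) ->
  (forall m w, I8 m -> good w -> `|X' m w| <= Y w) ->
  is_derive m (1 : R) (mean_on_good X) (mean_on_good X' m).
Proof.
move=> Im iX dX Y0 iY XY.
have d1 x w : I8 x -> good w -> partial1of2 X x w = X' x w.
  by move=> Ix gw; rewrite /partial1of2 derive1E; have D := dX _ _ Ix gw; exact: derive_val.
have df x w : I8 x -> good w -> derivable (X ^~ w) x 1.
  by move=> Ix gw; have D := dX _ _ Ix gw; exact: (@ex_derive _ _ _ _ _ _ _ D).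
have hb x w : I8 x -> good w -> `|partial1of2 X x w| <= Y w.
  by move=> Ix gw; rewrite d1// XY.
have hd := @derivable_under_integral R _ _ P X good mgood m (- 8^-1) (8^-1) Im iX df Y Y0 iY hb.
have he := @differentiation_under_integral R _ _ P X good mgood m (- 8^-1) (8^-1) Im iX df Y Y0 iY hb.
apply: DeriveDef => //; rewrite -derive1E; apply: (etrans he).
by apply: eq_Rintegral => w /set_mem gw; rewrite d1.
Qed.

Let G := mean_on_good L.

Lemma mean_log_derive m : I8 m -> is_derive m (1 : R) G (mean_on_good zt m).
Proof.
move=> Im; apply: (mean_on_good_derive Im logZmass_good_integrable _ (dom_ge0 1) (i_dom 1)).
  by move=> x w Ix gw; exact: logZmass_derive.
by move=> x w Ix gw; exact: (tilted_mean_le hH hW gw (I8P Ix)).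
Qed.

Lemma mean_tilted_mean_derive m : I8 m ->
  is_derive m (1 : R) (mean_on_good zt) (mean_on_good Vt m).
Proof.
move=> Im; apply: (mean_on_good_derive Im tilted_mean_good_integrable _ (dom_ge0 2) (i_dom 2)).
  by move=> x w Ix gw; exact: tilted_mean_derive.
by move=> x w Ix gw; exact: (tilted_var_le hH hW gw (I8P Ix)).
Qed.

Lemma mean_tilted_var_continuous : {in I8, continuous (mean_on_good Vt)}.
Proof.
apply: (@continuity_under_integral R _ _ P Vt good mgood (- 8^-1) (8^-1)
  tilted_var_good_integrable _ (fun w => moment_cst R 2 * dom1 w) (i_dom 2)).
  by apply: aeW => w gw; exact: tilted_var_continuous.
by move=> x Ix; apply: aeW => w gw; exact: (tilted_var_le hH hW gw (I8P Ix)).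
Qed.

Let I8_near m : I8 m -> \forall x \near m, I8 x.
Proof. by move=> Im; exact: near_in_itvoo. Qed.

Lemma derive1_mean_log m : I8 m -> derive1 G m = mean_on_good zt m.
Proof.
by move=> Im; rewrite derive1E; have D := mean_log_derive Im; exact: derive_val.
Qed.

Lemma derive1_mean_log_derive m : I8 m -> is_derive m (1 : R) (derive1 G) (mean_on_good Vt m).
Proof.
move=> Im; have D := mean_tilted_mean_derive Im.
apply: near_eq_is_derive D => //.
by apply: filterS (I8_near Im) => x Ix; rewrite derive1_mean_log.
Qed.

Lemma derive2_mean_log m : I8 m -> derive1n 2 G m = mean_on_good Vt m.
Proof.
move=> Im; rewrite derive1nS derive1n1 derive1E.
by have D := derive1_mean_log_derive Im; exact: derive_val.
Qed.

Lemma derive2_mean_log_continuous : {in I8, continuous (derive1n 2 G)}.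
Proof.
move=> m /set_mem Im; rewrite /continuous_at derive2_mean_log//.
have c := mean_tilted_var_continuous (mem_set Im).
apply: cvg_trans c; apply: near_eq_cvg.
by apply: filterS (I8_near Im) => x Ix; rewrite derive2_mean_log.
Qed.

End expected_log_mass.

(** * Mean and variance of zeta *)

Section variance.
Context d (T : measurableType d) (R : realType) (P : probability T R).
Variables (H : R) (W : R -> T -> R).
Hypothesis hH : 1 / 2 <= H <= 1.
Hypothesis hW : is_fBM P H W.
Local Notation M := (moment H W).
Local Notation zt := (tilted_mean H W 0).
Local Notation Vt := (tilted_var H W 0).
Local Notation good := (good H W).

Let mgood := measurable_good hH hW.
Let I80 : [set` `](- 8^-1 : R), 8^-1[] 0.
Proof. by rewrite /= in_itv/= oppr_lt0 invr_gt0 andbb ltr0n. Qed.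

Let goodE : setT `\` ~` good = good.
Proof. by rewrite setTD setCK. Qed.

Lemma integrable_good (f : T -> \bar R) : measurable_fun setT f ->
  P.-integrable good f -> P.-integrable setT f.
Proof.
move=> mf fi.
have := negligible_integrable (measurableC mgood) measurableT mf (goodC0 hH hW).
by rewrite goodE => h; apply/h.
Qed.

Lemma integral_good (f : T -> \bar R) : measurable_fun setT f ->
  P.-integrable good f -> (\int[P]_w f w = \int[P]_(w in good) f w)%E.
Proof.
move=> mf fi; rewrite (negligible_integral (measurableC mgood) measurableT _ (goodC0 hH hW)) ?goodE//.
exact: integrable_good.
Qed.

Lemma integral_indic_good (X : T -> R) :
  (\int[P]_w (\1_good w * X w)%:E = \int[P]_(w in good) (X w)%:E)%E.
Proof.
rewrite [RHS]integral_mkcond; apply: eq_integral => w _.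
by rewrite epatch_indic -EFinM mulrC.
Qed.

Lemma EFin_mean_on_good (X : R -> T -> R) m : P.-integrable good (EFin \o X m) ->
  (\int[P]_(w in good) (X m w)%:E = (mean_on_good P H W X m)%:E)%E.
Proof. by move=> iX; rewrite /mean_on_good /Rintegral fineK//; exact: integrable_fin_num. Qed.

Let iV : P.-integrable good (EFin \o Vt) := tilted_var_good_integrable hH hW I80.
Let iz : P.-integrable good (EFin \o zt) := tilted_mean_good_integrable hH hW I80.
Let i1 : P.-integrable good (fun=> 1%:E).
Proof. exact: finite_measure_integrable_cst. Qed.

(** The case [c = 0] of the identity. The right side is finite, and this is the source of the square
    integrability of [zt]. *)
Lemma integral_tilted_mean_sqr :
  (\int[P]_(w in good) (zt w ^+ 2)%:E = \int[P]_(w in good) (Vt w)%:E)%E.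
Proof.
have := tilted_var_mean_identity hH hW 0; rewrite !integral_indic_good.
under eq_integral do rewrite expr0n/= addr0.
by under [in X in _ = X -> _]eq_integral do rewrite addr0.
Qed.

Lemma tilted_mean_sqr_integrable : P.-integrable good (fun w => (zt w ^+ 2)%:E).
Proof.
apply/integrableP; split.
  apply/measurable_EFinP/measurable_funTS; apply: measurable_funX.
  exact: (measurable_tilted_mean hH hW).
under eq_integral do rewrite gee0_abs ?lee_fin ?sqr_ge0//.
by rewrite integral_tilted_mean_sqr; apply: integrable_lty.
Qed.

(** The case [c = 1] of the identity: once the case [c = 0] is subtracted, twice the mean must
    vanish. The subtraction is legitimate because all the integrals are finite. *)
Lemma integral_tilted_mean : (\int[P]_(w in good) (zt w)%:E = 0)%E.
Proof.
have := tilted_var_mean_identity hH hW 1; rewrite !integral_indic_good.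
under eq_integral do rewrite expr1n EFinD.
rewrite integralD//.
have -> : (\int[P]_(w in good) ((zt w + 1) ^+ 2)%:E = \int[P]_(w in good) (zt w ^+ 2)%:E +
    (2%:E * \int[P]_(w in good) (zt w)%:E + \int[P]_(w in good) 1%:E))%E.
  have i2 := tilted_mean_sqr_integrable.
  have i2z : P.-integrable good (fun w => 2%:E * (zt w)%:E)%E by exact: integrableZl.
  rewrite -integralZl// -integralD// -integralD//; last exact: integrableD.
  apply: eq_integral => w _; rewrite -EFinM -!EFinD; congr EFin.
  by ring.
rewrite integral_tilted_mean_sqr.
have fV := integrable_fin_num mgood iV.
have fz := integrable_fin_num mgood iz.
have f1 := integrable_fin_num mgood i1.
move: fV fz f1; rewrite /comp.
case: (\int[P]_(w in good) (Vt w)%:E)%E => [a| |]// _.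
case: (\int[P]_(w in good) (zt w)%:E)%E => [b| |]// _.
case: (\int[P]_(w in good) 1%:E)%E => [c| |]// _.
by rewrite -EFinM -!EFinD => -[] h; congr EFin; lra.
Qed.

Lemma zetaH_good w : good w -> zetaH H W w = zt w.
Proof.
move=> gw; have S0w : (dom_mass H W w < +oo)%E by case: gw.
have a8 : `|0 : R| <= 8^-1 by rewrite normr0 invr_ge0.
have iM := moment_integrable hH hW S0w 1 a8.
rewrite /zetaH -[RHS]/(fine (zt w)%:E); congr fine.
transitivity (\int[leb]_t ((M 0 0 w)^-1%:E * (t ^+ 1 * tilted H W 0 w t)%:E))%E.
  apply: eq_integral => t _; rewrite -EFinM /qdens -moment0; congr EFin.
  by rewrite /tilted mul0r addr0 ZprocE /log_Zproc expr1; ring.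
rewrite integralZl//.
have -> : (\int[leb]_t (t ^+ 1 * tilted H W 0 w t)%:E = (M 1 0 w)%:E)%E.
  by rewrite /moment /Rintegral fineK//; exact: integrable_fin_num.
by rewrite -EFinM mulrC.
Qed.

Lemma measurable_zetaH : measurable_fun setT (zetaH H W).
Proof.
apply: (measurableT_comp (f := fine)) => //.
apply: (@measurable_fun_integral_param _ T R (fun p => p.2 * qdens H W p.2 p.1)).
apply: measurable_funM => //; apply: measurable_funM.
  have h : measurable_fun setT (fun p : T * R => expR (log_Zproc H W p.2 p.1)).
    by apply: measurableT_comp => //; exact: (measurable_log_Zproc_joint hH hW).
  exact: h.
have -> : (fun p : T * R => (fine (Zmass H W 0 p.1))^-1) = (fun p => (M 0 0 p.1)^-1).
  by apply/funext => p; rewrite moment0.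
exact: (measurableT_comp (measurable_funV (measurable_moment hH hW 0 0)) measurable_fst).
Qed.

Lemma expectation_zetaH : ('E_P[zetaH H W] = 0)%E.
Proof.
rewrite unlock integral_good; last 2 first.
- by apply/measurable_EFinP; exact: measurable_zetaH.
- by apply: eq_integrable iz => // w /set_mem gw; rewrite /= zetaH_good.
rewrite -integral_tilted_mean; apply: eq_integral => w /set_mem gw.
by rewrite zetaH_good.
Qed.

Lemma variance_zetaH : ('V_P[zetaH H W] =
  (mean_on_good P H W (tilted_var H W) 0)%:E)%E.
Proof.
rewrite /variance unlock expectation_zetaH /= unlock.
transitivity (\int[P]_w (zetaH H W w ^+ 2)%:E)%E.
  by apply: eq_integral => w _; congr EFin; rewrite !fctE /= subr0 expr2.
rewrite integral_good; last 2 first.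
- by apply/measurable_EFinP; apply: measurable_funX; exact: measurable_zetaH.
- apply: eq_integrable tilted_mean_sqr_integrable => // w /set_mem gw.
  by rewrite zetaH_good.
rewrite -EFin_mean_on_good// -integral_tilted_mean_sqr; apply: eq_integral => w /set_mem gw.
by rewrite zetaH_good.
Qed.

End variance.

Theorem theorem3 (d : measure_display) (T : measurableType d) (R : realType)
  (P : probability T R) (H : R) (W : R -> T -> R) :
  1 / 2 <= H <= 1 ->
  is_fBM P H W ->
  exists G : R -> R,
    [/\ (forall m : R, - (1 / 8) < m < 1 / 8 ->
           [/\ {ae P, forall w, (Zmass H W m w < +oo)%E},
               P.-integrable setT (fun w => (logZmass H W m w)%:E) &
               ('E_P[logZmass H W m] = (G m)%:E)%E]),
        (forall m : R, - (1 / 8) < m < 1 / 8 ->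
           derivable G m 1 /\ derivable (derive1 G) m 1),
        {in `](- (1 / 8)), (1 / 8)[, continuous (derive1n 2 G)} &
        ('V_P[zetaH H W] = (derive1n 2 G 0)%:E)%E].
Proof.
move=> hH hW; rewrite !div1r; exists (mean_on_good P H W (logZmass H W)).
have I8 (m : R) : - 8^-1 < m < 8^-1 -> [set` `](- 8^-1 : R), 8^-1[] m by rewrite /= in_itv.
split.
- move=> m /I8 Im; have iL := logZmass_good_integrable hH hW Im.
  have mL : measurable_fun setT (fun w => (logZmass H W m w)%:E).
    by apply/measurable_EFinP; exact: (measurable_logZmass hH hW).
  split.
  + exists (~` good H W); split.
    * exact/measurableC/(measurable_good hH hW).
    * exact: (goodC0 hH hW).
    * move=> w /=; apply: contra_not => -[S0w _].
      apply: le_lt_trans (Zmass_le hH hW _ S0w) _; last by rewrite ltry.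
      move: Im; rewrite /= in_itv/= => h.
      by apply: (@le_trans _ _ 8^-1); [rewrite ltW// ltr_norml|lra].
  + exact: (integrable_good hH hW).
  + by rewrite unlock (integral_good hH hW)// EFin_mean_on_good.
- move=> m /I8 Im; split.
    by have D := mean_log_derive hH hW Im; exact: (@ex_derive _ _ _ _ _ _ _ D).
  by have D := derive1_mean_log_derive hH hW Im; exact: (@ex_derive _ _ _ _ _ _ _ D).
- move=> m; rewrite in_itv/= => /I8 Im.
  by apply: (derive2_mean_log_continuous hH hW); exact: mem_set.
- rewrite (variance_zetaH hH hW) derive2_mean_log//.
  by apply: I8; rewrite oppr_lt0 invr_gt0 andbb ltr0n.
Qed.
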